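(* Let $X$ be a nonempty quadric complex. Then the flag bisimplicial completion $\mathcal{B}(X^1)$ of the $1$-skeleton $X^1$ of $X$ is contractible.
   Context: Quadric complexes. A square complex is a $2$-dimensional CW complex whose $2$-cells (squares) are attached along closed combinatorial paths of length $4$ in the $1$-skeleton. A square complex $X$ is flag if each square is bounded by an embedded $4$-cycle and each embedded $4$-cycle of $X^1$ bounds a unique square. A quadric complex is a locally finite, connected square complex $X$ such that $X$ is flag and every isometrically embedded cycle of $X^1$ (cycles of length $1$ and $2$ included, so that $X^1$ has no loops or multiple edges) has length $4$; here $X^1$ carries the shortest-path metric. The $1$-skeleton of a quadric complex is bipartite. Bisimplices. A bipartitioned set is a set $S$ with a bipartition $S=A\sqcup B$ into possibly empty parts; a subset $T\subseteq S$ has the induced bipartition $(T\cap A)\sqcup(T\cap B)$. It is spanworthy if $S\neq\emptyset$ and ($|A|\le 1 \Leftrightarrow |B|\le 1$). A regular CW complex is a CW complex whose characteristic maps are embeddings; its cell poset is the set of its cells ordered by inclusion, and it is determined by its cell poset. The $(m,n)$-bisimplex $B^{m,n}$ is the regular CW complex (a ball, with a single top-dimensional cell) whose cell poset is isomorphic to the poset of spanworthy subsets of a spanworthy bipartitioned set $A\sqcup B$ with $|A|=m+1$, $|B|=n+1$, ordered by inclusion. For $m,n\ge 1$ its dimension is $m+n$ and its $1$-skeleton is the complete bipartite graph $K_{m+1,n+1}$. Its boundary $\partial B^{m,n}$ is the subcomplex of all cells other than the top one. Flag bisimplicial completion. For a graph $\Gamma$, $\mathcal{B}(\Gamma)$ is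 defined inductively on skeleta: its $1$-skeleton is $\Gamma$; for $k\ge 2$, given the $(k-1)$-skeleton, the $k$-skeleton is obtained by gluing, for each subcomplex of the $(k-1)$-skeleton isomorphic to some $\partial B^{m,n}$ with $\dim B^{m,n}=k$, one copy of $B^{m,n}$ along that isomorphism. *)

(* Defs.v *)
From HB Require Import structures.
From mathcomp Require Import all_boot all_order all_algebra.
From mathcomp Require Import all_classical all_reals all_analysis.
Import Order.TTheory GRing.Theory Num.Theory.
Import numFieldNormedType.Exports.
Set Implicit Arguments.
Unset Strict Implicit.
Unset Printing Implicit Defensive.
Local Open Scope classical_set_scope.

(* A graph, i.e. a 1-dimensional CW complex: an (unoriented) edge is a pair
   {d, rev d} of opposite darts.  Loops and multiple edges are allowed. *)
Record graph := Graph {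
  vertex : Type;
  dart : Type;
  src : dart -> vertex;
  rev : dart -> dart;
  revK : involutive rev;
  rev_neq : forall d, rev d <> d
}.
Arguments vertex : clear implicits.
Arguments dart : clear implicits.

Section Graphs.
Variable G : graph.

Definition tgt (d : dart G) : vertex G := src (rev d).

Fixpoint is_walk (u : vertex G) (p : seq (dart G)) (v : vertex G) : Prop :=
  if p is d :: p' then src d = u /\ is_walk (tgt d) p' v else u = v.

Definition connected_graph : Prop := forall u v, exists p, is_walk u p v.

Definition is_dist (u v : vertex G) (n : nat) : Prop :=
  (exists2 p, is_walk u p v & size p = n) /\
  (forall p, is_walk u p v -> n <= size p).

(* Indices of closed paths are read cyclically; [ordS] is the cyclic
   successor. *)
Definition closed_path n (c : 'I_n -> dart G) : Prop :=
  forall i, tgt (c i) = src (c (ordS i)).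

(* An embedding of the cycle graph of length n: injective on vertices and on
   edges.  Injectivity on edges only matters for n = 2. *)
Definition embedded_cycle n (c : 'I_n -> dart G) : Prop :=
  [/\ 0 < n, closed_path c, injective (fun i => src (c i)) &
      forall i j, c i <> rev (c j)].

Definition cycle_dist n (i j : 'I_n) : nat :=
  let d := (i - j) + (j - i) in minn d (n - d).

Definition isometric_cycle n (c : 'I_n -> dart G) : Prop :=
  embedded_cycle c /\
  forall i j, is_dist (src (c i)) (src (c j)) (cycle_dist i j).

(* The edges traversed by a path, as a set of darts closed under [rev]. *)
Definition trace n (c : 'I_n -> dart G) : set (dart G) :=
  [set d | exists i, d = c i \/ d = rev (c i)].

Definition edge := {e : set (dart G) | exists d, e = [set d; rev d]}.

Definition incident (v : vertex G) (e : edge) : Prop :=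
  exists2 d, sval e d & src d = v.

End Graphs.

Record square_complex := SquareComplex {
  skeleton1 : graph;
  square : Type;
  bdry : square -> 'I_4 -> dart skeleton1;
  bdry_closed : forall f, closed_path (bdry f)
}.
Arguments square : clear implicits.

Section Quadric.
Variable X : square_complex.

Definition flag : Prop :=
  (forall f : square X, embedded_cycle (bdry f)) /\
  (forall c : 'I_4 -> dart (skeleton1 X), embedded_cycle c ->
     exists! f : square X, trace (bdry f) = trace c).

Definition locally_finite : Prop :=
  forall v : vertex (skeleton1 X),
    finite_set [set d : dart (skeleton1 X) | src d = v] /\
    finite_set [set f : square X | exists i, src (bdry f i) = v].

Definition quadric : Prop :=
  [/\ locally_finite, connected_graph (skeleton1 X), flag &
      forall n (c : 'I_n -> dart (skeleton1 X)), isometric_cycle c -> n = 4].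

End Quadric.

(* A regular CW complex is given by its cell poset, which determines it; the
   associated space is [realization] below. *)
Record cell_poset := CellPoset {
  cell :> Type;
  cell_le : cell -> cell -> Prop
}.

Definition subcomplex (P : cell_poset) (S : set P) : Prop :=
  forall x y : P, cell_le x y -> S y -> S x.

Definition isomorphic_on (P Q : cell_poset) (A : set P) (B : set Q) : Prop :=
  exists phi : P -> Q, set_bij A B phi /\
    forall s t, A s -> A t -> (cell_le (phi s) (phi t) <-> cell_le s t).

(* A bipartitioned finite set is a disjoint sum of finite types. *)
Definition spanworthy (A B : finType) (T : {set A + B}) : bool :=
  (T != finset.set0) &&
  ((#|[set a | inl a \in T]%SET| <= 1) == (#|[set b | inr b \in T]%SET| <= 1)).

Definition bisimplex (m n : nat) : cell_poset :=
  @CellPoset {T : {set 'I_m.+1 + 'I_n.+1} | spanworthy T}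
    (fun U V => val U \subset val V).

Definition bisimplex_boundary (m n : nat) : set (bisimplex m n) :=
  [set T | val T != [set: 'I_m.+1 + 'I_n.+1]%SET].

(* A graph is a regular CW complex, determined by its cell poset, when it has
   no loops; multiple edges are harmless. *)
Definition graph_cells (G : graph) : cell_poset :=
  @CellPoset (vertex G + edge G)
    (fun x y => match x, y with
     | inl v, inl w => v = w
     | inl v, inr e => incident v e
     | inr _, inl _ => False
     | inr e, inr f => e = f
     end).

(* For k >= 2, a bisimplex B^{m,n} of dimension k has m, n >= 1 and
   k = m + n. *)
Definition is_bisimplex_boundary (P : cell_poset) (k : nat) (S : set P) : Prop :=
  subcomplex S /\
  exists m n, [/\ 0 < m, 0 < n, m + n = k &
    isomorphic_on (@bisimplex_boundary m n) S].

(* One new cell for each boundary subcomplex, lying above exactly the cells of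
   that subcomplex. *)
Definition glue (P : cell_poset) (k : nat) : cell_poset :=
  @CellPoset (P + {S : set P | is_bisimplex_boundary k S})
    (fun x y => match x, y with
     | inl a, inl b => cell_le a b
     | inl a, inr c => sval c a
     | inr _, inl _ => False
     | inr c, inr d => c = d
     end).

(* [skeleton G n] is the (n+1)-skeleton of the flag bisimplicial completion. *)
Fixpoint skeleton (G : graph) (n : nat) : cell_poset :=
  if n is n'.+1 then glue (skeleton G n') n'.+2 else graph_cells G.

(* The inclusion of each skeleton into the next one. *)
Definition push (G : graph) (x : {n & skeleton G n}) : {n & skeleton G n} :=
  existT (fun n => skeleton G n : Type) (projT1 x).+1 (inl (projT2 x)).

(* The union of the skeleta: a cell is represented in the first skeleton
   containing it, and two cells are compared in a common skeleton. *)
Definition completion (G : graph) : cell_poset :=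
  @CellPoset {x : {n & skeleton G n} | forall y, x <> push y}
    (fun x y => exists i j n (c d : skeleton G n),
       [/\ iter i (@push G) (sval x) = existT _ n c,
           iter j (@push G) (sval y) = existT _ n d & cell_le c d]).

Section Realization.
Local Open Scope ring_scope.
Variables (R : realType) (P : cell_poset).

(* The geometric realization of the order complex of the cell poset, which is
   the barycentric subdivision of the regular CW complex: points are given by
   barycentric coordinates on finite chains of cells. *)
Record realization := Realization {
  coord : P -> R;
  coord_fin : finite_set [set x | coord x != 0];
  coord_chain : forall x y, coord x != 0 -> coord y != 0 ->
    cell_le x y \/ cell_le y x;
  coord_ge0 : forall x, 0 <= coord x;
  coord_sum : \sum_(x \in [set: {classic P}]) coord x = 1
}.

Definition chain (C : set P) : Prop :=
  forall x y, C x -> C y -> cell_le x y \/ cell_le y x.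

Definition carried (C : set P) (t : realization) : Prop :=
  forall x, coord t x != 0 -> C x.

(* The weak topology: U is open iff its trace on every closed simplex (with
   its Euclidean topology) is open in that simplex. *)
Definition weak_open (U : set realization) : Prop :=
  forall C : set P, finite_set C -> chain C ->
  forall t, U t -> carried C t ->
  exists2 e : R, 0 < e &
    forall t', carried C t' -> (forall x, `|coord t' x - coord t x| < e) -> U t'.

Lemma weak_openT : weak_open setT.
Proof. by move=> C _ _ t _ _; exists 1. Qed.

Lemma weak_openI : setI_closed weak_open.
Proof.
move=> U V oU oV C Cfin Cch t [Ut Vt] Ct.
have [e e0 He] := oU C Cfin Cch t Ut Ct.
have [f f0 Hf] := oV C Cfin Cch t Vt Ct.
exists (Num.min e f); first by rewrite lt_min e0.
move=> t' Ct' H; split; [apply: He => // x|apply: Hf => // x];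
  by have := H x; rewrite lt_min => /andP[].
Qed.

Lemma weak_open_bigU (I : Type) (f : I -> set realization) :
  (forall i, weak_open (f i)) -> weak_open (\bigcup_i f i).
Proof.
move=> of_ C Cfin Cch t [i _ fit] Ct.
have [e e0 He] := of_ i C Cfin Cch t fit Ct.
by exists e => // t' Ct' H; exists i => //; apply: He.
Qed.

HB.instance Definition _ := gen_eqMixin realization.
HB.instance Definition _ := gen_choiceMixin realization.
HB.instance Definition _ := isOpenTopological.Build realization
  weak_openT weak_openI weak_open_bigU.

End Realization.

Section Contractible.
Local Open Scope ring_scope.

Definition contractible (R : realType) (T : topologicalType) : Prop :=
  exists (x0 : T) (H : T * R -> T),
    [/\ {within [set: T] `*` `[0, 1], continuous H},
        forall x, H (x, 0) = x & forall x, H (x, 1) = x0].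

End Contractible.

(* Main.v *)
(* Since isometric cycles have length 4, the graph is bipartite and satisfies the
   quadrangle condition, so that every vertex [v] at distance [n >= 2] from a base
   vertex has a companion [fold v] at distance [n - 2] adjacent to all neighbours
   of [v] at distance [n - 1].  Cells of the completion are vertex sets: single
   vertices, and complete bipartite sets that are not stars with several leaves.
   In the larger poset obtained by adding these stars and the pairs
   [{v, fold v}], folding the n-th sphere is a zigzag of monotone maps
   [T <= T ∪ fold T >= fold T]; performing these folds for n = ..., 3, 2, 1 in a
   finite time contracts its order complex, the infinite concatenation being
   continuous because the poset is locally finite.  The added pairs, then the
   added stars, are removed by retractions, since their links contract by
   zigzags of length two. *)
From mathcomp Require Import all_boot all_order all_algebra.
From mathcomp Require Import finmap.
From mathcomp Require Import all_classical all_reals all_analysis.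
From mathcomp Require Import zify ring lra.
Require Import Defs.
Import Order.TTheory GRing.Theory Num.Theory.
Import numFieldNormedType.Exports.

Set Implicit Arguments.
Unset Strict Implicit.
Unset Printing Implicit Defensive.
Local Open Scope classical_set_scope.

(** * Graph distance and bipartiteness *)

(** Both kinds of added sets are forced by the folds. A square with vertices [v], [a], [fold v], [b]
    is sent to the star of [fold v] with leaves [a] and [b], which is no cell; and for a single
    vertex [v] the zigzag needs a set containing both [v] and [fold v], which are not adjacent.
    Enlarging the poset is harmless because a retract of a contractible space is contractible: to
    remove the additions again, only a retraction has to be constructed, not a homotopy equivalence.
    All homotopies are explicit formulas in barycentric coordinates, so two things must be
    controlled each time: the support must remain a chain, which decides the order in which mass is
    moved, and continuity must hold in the weak topology, which local finiteness reduces to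
    continuity of every single coordinate. *)

Section Distance.
Variable G : graph.
Implicit Types (u v w : vertex G) (d : dart G) (n m : nat).

Definition adj u v : Prop := exists2 d : dart G, src d = u & tgt d = v.

Definition walk n u v : Prop := exists2 p, is_walk u p v & size p = n.

Lemma tgt_rev d : tgt (rev d) = src d.
Proof. by rewrite /tgt revK. Qed.

Lemma adj_sym u v : adj u v -> adj v u.
Proof. by move=> [d <- <-]; exists (rev d); rewrite ?tgt_rev. Qed.

Lemma walk0 u v : walk 0 u v <-> u = v.
Proof.
split=> [[[|d p] //]|->]; by [|exists [::]].
Qed.

Lemma walkS n u v : walk n.+1 u v <-> exists2 w, adj u w & walk n w v.
Proof.
split=> [[[|d p] //= [du wp] [sp]]|[w [d du dw] [p wp sp]]].
  by exists (tgt d); [exists d|exists p].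
by exists (d :: p); rewrite /= ?dw ?sp.
Qed.

Lemma walk_adj u v : adj u v -> walk 1 u v.
Proof. by move=> a; apply/walkS; exists v => //; apply/walk0. Qed.

Lemma walk_cat n m u v w : walk n u v -> walk m v w -> walk (n + m) u w.
Proof.
elim: n u => [|n IH] u; first by move=> /walk0 ->.
move=> /walkS [x ux xv] vw; rewrite addSn; apply/walkS; exists x => //.
exact: IH.
Qed.

Lemma walk_sym n u v : walk n u v -> walk n v u.
Proof.
elim: n u => [|n IH] u; first by move=> /walk0 ->; apply/walk0.
move=> /walkS [x ux xv]; rewrite -addn1; apply: walk_cat (IH _ xv) _.
exact/walk_adj/adj_sym.
Qed.

Lemma walk_nth n u v : walk n u v ->
  exists x : nat -> vertex G, [/\ x 0 = u, x n = v &
    forall i, i < n -> adj (x i) (x i.+1)].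
Proof.
elim: n u => [|n IH] u; first by move=> /walk0 ->; exists (fun=> v).
move=> /walkS [w uw /IH [x [x0 xn xa]]].
exists (fun i => if i is j.+1 then x j else u); split=> // -[|i] ltin //=.
  by rewrite x0.
exact: xa.
Qed.

Lemma walk_sub (x : nat -> vertex G) n i j :
  (forall i, i < n -> adj (x i) (x i.+1)) -> i <= j -> j <= n ->
  walk (j - i) (x i) (x j).
Proof.
move=> xa; elim: j => [|j IH].
  by rewrite leqn0 => /eqP-> _; apply/walk0.
rewrite leq_eqVlt => /predU1P[<- _|ltij ltjn].
  by rewrite subnn; apply/walk0.
rewrite subSn // -addn1; apply: walk_cat (IH _ (ltnW ltjn)) _ => //.
exact/walk_adj/xa.
Qed.

Hypothesis conn : connected_graph G.

Lemma walk_ex u v : exists n, `[< walk n u v >].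
Proof. by have [p wp] := conn u v; exists (size p); apply/asboolP; exists p. Qed.

Definition gdist u v : nat := ex_minn (walk_ex u v).

Lemma walk_gdist u v : walk (gdist u v) u v.
Proof. by rewrite /gdist; case: ex_minnP => m /asboolP. Qed.

Lemma gdist_min n u v : walk n u v -> gdist u v <= n.
Proof. by rewrite /gdist; case: ex_minnP => m _ + /asboolP; apply. Qed.

Lemma gdist_is_dist u v : is_dist u v (gdist u v).
Proof.
split; first exact: walk_gdist.
by move=> p wp; apply: gdist_min; exists p.
Qed.

Lemma gdist_eq0 u v : gdist u v = 0 -> u = v.
Proof. by move=> d0; apply/walk0; rewrite -d0; apply: walk_gdist. Qed.

Lemma gdistxx u : gdist u u = 0.
Proof. by apply/eqP; rewrite -leqn0; apply/gdist_min/walk0. Qed.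

Lemma gdistC u v : gdist u v = gdist v u.
Proof.
by apply/eqP; rewrite eqn_leq; apply/andP; split; apply/gdist_min/walk_sym/walk_gdist.
Qed.

Lemma gdist_triangle u v w : gdist u w <= gdist u v + gdist v w.
Proof. by apply/gdist_min/walk_cat; apply: walk_gdist. Qed.

Lemma gdist_step n u v : gdist u v = n.+1 ->
  exists2 w, adj u w & gdist w v = n.
Proof.
move=> duv; have := walk_gdist u v; rewrite duv => /walkS [w uw wv].
exists w => //; apply/eqP; rewrite eqn_leq gdist_min //=.
rewrite -ltnS -duv; apply: gdist_min; apply/walkS; exists w => //.
exact: walk_gdist.
Qed.

Hypothesis iso4 : forall n (c : 'I_n -> dart G), isometric_cycle c -> n = 4.

Lemma no_loop u : ~ adj u u.
Proof.
move=> [d du dv]; suff: 1 = 4 by [].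
apply: (iso4 (c := fun=> d)); split; first split=> //.
- by move=> i; rewrite dv.
- by move=> i j _; rewrite !ord1.
- by move=> _ _ /esym; apply: rev_neq.
move=> i j; rewrite !ord1 du.
by have := gdist_is_dist u u; rewrite gdistxx.
Qed.

Lemma gdist_adj u v : adj u v -> gdist u v = 1.
Proof.
move=> uv; apply/eqP; rewrite eqn_leq gdist_min ?lt0n; last exact: walk_adj.
by apply/eqP => /gdist_eq0 eq_uv; apply: (@no_loop u); rewrite {2}eq_uv.
Qed.

Lemma adj_gdist u v : gdist u v = 1 -> adj u v.
Proof. by move=> /gdist_step[w uw /gdist_eq0 <-]. Qed.

(** Two different parallel darts would form an isometric cycle of length 2. *)
Lemma dart_inj d d' : src d = src d' -> tgt d = tgt d' -> d = d'.
Proof.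
move=> ss tt; apply: contrapT => dd'; suff: 2 = 4 by [].
pose c (i : 'I_2) := if i == ord0 then d else rev d'.
have E (i : 'I_2) : i = ord0 \/ i = ord_max.
  by case: i => -[|[|//]] h; [left|right]; apply: val_inj.
have dst : src d <> tgt d.
  by move=> e; apply: (@no_loop (src d)); exists d.
apply: (iso4 (c := c)); split; first split=> //.
- by move=> i; case: (E i) => ->; rewrite /c /=  ?tgt_rev ?ss // tt.
- move=> i j; case: (E i) => ->; case: (E j) => -> //; rewrite /c /=;
  by rewrite -[src (rev d')]/(tgt d') -tt => e; case: dst; rewrite ?e.
- move=> i j; case: (E i) => ->; case: (E j) => ->; rewrite /c /= ?revK.
  + by move=> /esym; apply: rev_neq.
  + exact.
  + by move=> e; apply: dd'; rewrite -[d]revK -e revK.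
  + by apply: rev_neq.
have ad : adj (src d) (tgt d) by exists d.
move=> i j; case: (E i) => ->; case: (E j) => ->; rewrite /c /=;
  rewrite -?[src (rev d')]/(tgt d') -?tt.
- by have := gdist_is_dist (src d) (src d); rewrite gdistxx.
- by have := gdist_is_dist (src d) (tgt d); rewrite gdist_adj.
- have := gdist_is_dist (tgt d) (src d); rewrite gdist_adj //; exact: adj_sym.
- by have := gdist_is_dist (tgt d) (tgt d); rewrite gdistxx.
Qed.

(** For [2 < n] the distances force distinct vertices and these force distinct edges, so a cycle can
    be given by its vertices alone. *)
Lemma isometric_nth n (x : nat -> vertex G) : 2 < n ->
  (forall i, i < n -> adj (x i) (x (i.+1 %% n))) ->
  (forall i j, i < j < n ->
     gdist (x i) (x j) = minn (j - i) (n - (j - i))) -> n = 4.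
Proof.
move=> n2 xa xd.
have [c cP] : exists c : 'I_n -> dart G, forall i : 'I_n,
    src (c i) = x i /\ tgt (c i) = x (i.+1 %% n).
  have /choice[c cP] : forall i : 'I_n, exists d : dart G,
      src d = x i /\ tgt d = x (i.+1 %% n).
    by move=> i; have [d s t] := xa i (ltn_ord i); exists d.
  by exists c.
have dist (i j : 'I_n) : gdist (x i) (x j) = cycle_dist i j.
  rewrite /cycle_dist; have [ltij|ltji|/val_inj ->] := ltngtP i j.
  - by rewrite xd ?ltij ?ltn_ord // (_ : i - j = 0) //; lia.
  - rewrite gdistC xd ?ltji ?ltn_ord // (_ : j - i = 0) ?addn0 //; lia.
  - by rewrite gdistxx subnn min0n.
have inj (i j : 'I_n) : x i = x j -> i = j.
  move=> e; apply: val_inj => /=; have := dist i j; rewrite e gdistxx.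
  rewrite /cycle_dist; have := ltn_ord i; have := ltn_ord j; lia.
have n0 : 0 < n by lia.
apply: (iso4 (c := c)); split; first split=> //.
- by move=> i; rewrite (cP i).2 (cP _).1.
- by move=> i j /=; rewrite !(cP _).1; apply: inj.
- move=> i j e.
  have /inj/(congr1 val)/= e1 : x i = x (ordS j).
    by rewrite -(cP i).1 e -[src (rev _)]/(tgt _) (cP j).2.
  have /inj/(congr1 val)/= e2 : x (ordS i) = x j.
    by rewrite -(cP j).1 -tgt_rev -e (cP i).2.
  have := ltn_ord i; have := ltn_ord j; move: e1 e2 => + + lj li.
  have M (k : nat) : k < n -> k.+1 %% n = if k.+1 == n then 0 else k.+1.
    by move=> ltk; case: eqP => [->|ne]; rewrite ?modnn ?modn_small //; lia.
  rewrite !M //; do 2!case: eqP; lia.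
- by move=> i j; rewrite !(cP _).1 -dist; apply: gdist_is_dist.
Qed.

(** Two vertices cut a shortest odd closed walk into arcs of opposite parity. A geodesic between
    them closes with one of the arcs to an odd walk, which is no shorter than the whole; so the
    geodesic is at least as long as the other arc. Thus the walk is an isometric cycle, and its
    length would be 4. Length 1 is a loop and is treated apart. *)
Lemma closed_walk_even n u : walk n u u -> ~~ odd n.
Proof.
move=> wn; apply/negP => on.
have ex : exists n, `[< odd n /\ exists u, walk n u u >].
  by exists n; apply/asboolP; split => //; exists u.
case: (ex_minnP ex) => {wn on n u} n /asboolP[on [u wn]] nmin.
have {}nmin m v : walk m v v -> odd m -> n <= m.
  by move=> wm om; apply: nmin; apply/asboolP; split=> //; exists v.
have [n1|n1] := eqVneq n 1.
  by move: wn; rewrite n1 => /walkS[w uw /walk0 e]; apply: (@no_loop u); rewrite -{2}e.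
have n2 : 2 < n by case: n on n1 {wn nmin} => [|[|[]]].
have [x [x0 xn xa]] := walk_nth wn.
suff n4 : n = 4 by rewrite n4 in on.
apply: (isometric_nth (x := x)) => //.
  move=> i ltin; have [eqn|ne] := eqVneq i.+1 n.
    by rewrite eqn modnn x0 -xn -eqn; apply: xa.
  by rewrite modn_small; [apply: xa|lia].
move=> i j /andP[ltij ltjn].
have W1 : walk (j - i) (x i) (x j) by apply: (walk_sub xa); lia.
have W2 : walk (n - (j - i)) (x j) (x i).
  rewrite (_ : n - (j - i) = (n - j) + (i - 0)); last lia.
  apply: (walk_cat (v := x 0)); last by apply: (walk_sub xa); lia.
  by rewrite x0 -xn; apply: (walk_sub xa); lia.
have W := walk_gdist (x i) (x j).
have le1 := gdist_min W1.
have le2 := gdist_min W2; rewrite gdistC in le2.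
have l1 := nmin _ _ (walk_cat W (walk_sym W1)).
have l2 := nmin _ _ (walk_cat W W2).
move: on le1 le2 l1 l2 ltij ltjn; move: (gdist _ _) => D; lia.
Qed.

End Distance.

(** * The quadrangle condition *)

Section Quadrangle.
Variable G : graph.
Hypothesis conn : connected_graph G.
Hypothesis iso4 : forall n (c : 'I_n -> dart G), isometric_cycle c -> n = 4.
Local Notation D := (gdist conn).
Implicit Types (u v w x y z a b : vertex G) (i j k n : nat).

Let Dadj u v : adj u v -> D u v = 1 := fun h => gdist_adj conn iso4 h.

Lemma gdist_even u v w : ~~ odd (D u v + D v w + D w u).
Proof.
apply: (closed_walk_even conn iso4 (u := u)).
by apply: walk_cat (walk_gdist conn w u); apply: walk_cat; apply: walk_gdist.
Qed.

Lemma gdist_adj_cases x u v : adj u v -> D x u = (D x v).+1 \/ D x v = (D x u).+1.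
Proof.
move=> /[dup] /Dadj uv /adj_sym/Dadj vu.
have := gdist_triangle conn x u v; have := gdist_triangle conn x v u.
have := gdist_even x u v; rewrite uv vu (gdistC _ v x); lia.
Qed.

(** By parity, nonadjacent opposite vertices of the hexagon have distance 3, so without long
    diagonals it is isometric. *)
Lemma hexagon a b c d e f :
  adj a b -> adj b c -> adj c d -> adj d e -> adj e f -> adj f a ->
  a <> c -> b <> d -> c <> e -> d <> f -> e <> a -> f <> b ->
  ~ adj a d -> ~ adj b e -> ~ adj c f -> False.
Proof.
move=> ab bc cd de ef fa ac bd ce df ea fb ad be cf.
have two u v w : adj u v -> adj v w -> u <> w -> D u w = 2.
  move=> uv vw; have := gdist_triangle conn u v w; have := gdist_even u v w.
  rewrite (Dadj uv) (Dadj vw) (gdistC _ w u) => H1 H2 uw.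
  by have : D u w <> 0 by [move=> /gdist_eq0]; lia.
have three u v t : adj u v -> D v t = 2 -> ~ adj u t -> D u t = 3.
  move=> uv vt ut.
  have : D u t <> 1 by move=> /adj_gdist.
  have := gdist_triangle conn u v t; have := gdist_even u v t.
  rewrite (Dadj uv) vt (gdistC _ t u); lia.
suff : 6 = 4 by [].
apply: (isometric_nth (conn := conn) iso4 (n := 6) (x := nth a [:: a; b; c; d; e; f])) => //.
  by do 6![case=> //].
have Dac := two _ _ _ ab bc ac.
have Dbd := two _ _ _ bc cd bd.
have Dce := two _ _ _ cd de ce.
have Ddf := two _ _ _ de ef df.
have Dea := two _ _ _ ef fa ea.
have Dfb := two _ _ _ fa ab fb.
move=> [|[|[|[|[|[|i]]]]]] [|[|[|[|[|[|j]]]]]] //=; rewrite ?andbF // => _;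
  rewrite ?(Dadj ab, Dadj bc, Dadj cd, Dadj de, Dadj ef, Dac, Dbd, Dce, Ddf) //.
- exact: three ab Dbd ad.
- by rewrite gdistC Dea.
- by rewrite gdistC Dadj.
- exact: three bc Dce be.
- by rewrite gdistC Dfb.
- exact: three cd Ddf cf.
Qed.

Lemma geodesic z v n (x : nat -> vertex G) :
    x 0 = z -> x n = v -> (forall i, i < n -> adj (x i) (x i.+1)) ->
    D z v = n ->
  forall i j, i <= j -> j <= n -> D (x i) (x j) = j - i.
Proof.
move=> x0 xn xa dn i j leij lejn.
have l1 := gdist_min conn (walk_sub xa leij lejn).
have l2 := gdist_min conn (walk_sub xa (leq0n i) (leq_trans leij lejn)).
have l3 := gdist_min conn (walk_sub xa lejn (leqnn n)).
have t1 := gdist_triangle conn (x 0) (x i) (x n).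
have t2 := gdist_triangle conn (x i) (x j) (x n).
move: l1 l2 l3 t1 t2; rewrite x0 xn dn; lia.
Qed.

Lemma geodesic_through z v a k :
    D z v = k.+1 -> adj v a -> D z a = k ->
  exists p : nat -> vertex G, [/\ p 0 = z, p k = a, p k.+1 = v &
    forall i j, i <= j -> j <= k.+1 -> D (p i) (p j) = j - i].
Proof.
move=> zv va za; have := walk_gdist conn z a; rewrite za => /walk_nth[x [x0 xk xa]].
pose p i := if i <= k then x i else v.
have p0 : p 0 = z by rewrite /p.
have pk : p k = a by rewrite /p leqnn.
have pk1 : p k.+1 = v by rewrite /p ltnn.
exists p; split=> //; apply: (geodesic p0 pk1) => // i; rewrite ltnS leq_eqVlt.
move=> /predU1P[->|ltik]; first by rewrite pk pk1; apply: adj_sym.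
by rewrite /p ltik ltnW //; apply: xa.
Qed.

Definition quadrangle_at k : Prop := forall z v a b,
  D z v = k.+1 -> adj v a -> adj v b -> D z a = k -> D z b = k -> 0 < k ->
  exists w, [/\ adj w a, adj w b & D z w = k.-1].

(* Below the range where the quadrangle condition is known, the graph has
   medians: if [z] is not between [u] and [b], then some neighbour of [z] is
   closer to both. *)
Lemma descend k z b : (forall k', k' < k -> quadrangle_at k') ->
  forall i u, D z u = i -> D b u < i + D z b -> i + D z b <= k.+1 ->
  exists x, [/\ adj z x, D x u = i.-1 & D x b = (D z b).-1].
Proof.
move=> IHk; elim=> [|i IH] u zu bu lek.
  by move: bu; rewrite -(gdist_eq0 zu) gdistC; lia.
have [p up pz] : exists2 p, adj u p & D p z = i by apply: gdist_step; rewrite gdistC.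
have zp : D z p = i by rewrite gdistC.
have extend q x : adj u q -> adj z x -> D x q = i.-1 -> 0 < i -> D x u = i.
  move=> uq zx xq i0; have := gdist_triangle conn z x u.
  have := gdist_triangle conn x q u; have := Dadj zx.
  have := Dadj (adj_sym uq); lia.
have bz := gdistC conn b z.
have tp := gdist_triangle conn b z p.
have cases := gdist_adj_cases b up.
have [bp|bp] := ltnP (D b p) (i + D z b).
  have [x [zx xp xb]] := IH p zp bp (leqW lek : _ <= _.+2).
  exists x; split=> //=; apply: (extend p) => //.
  by case: (i) zp bp => // /gdist_eq0 <-; lia.
have bp' : D b p = i + D z b by lia.
have bu' : D b u = (i + D z b).-1 /\ 0 < i + D z b by lia.
have tu := gdist_triangle conn z b u.
have [i0|i0] := posnP i.
  have zz : z = p by apply: (@gdist_eq0 _ conn); rewrite zp.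
  exists u; split=> /=; first by rewrite zz; apply: adj_sym.
  - by rewrite gdistxx.
  - by rewrite gdistC; lia.
(* Now [p] is as far from [b] as a path through [z] permits, so [u] and [q], the next vertex towards
   [z], are both one step nearer to [b]. Their common neighbour [w], obtained with base [b], is
   again at distance [i] from [z] and satisfies the inequality of the induction hypothesis. *)
have [q pq qz] : exists2 q, adj p q & D q z = i.-1.
  by apply: gdist_step; rewrite pz prednK.
have zq : D z q = i.-1 by rewrite gdistC.
have bq : D b q = (i + D z b).-1.
  by have := gdist_triangle conn b z q; have := gdist_adj_cases b pq; lia.
have [w [wq wu bw]] : exists w, [/\ adj w q, adj w u & D b w = (i + D z b).-1.-1].
  apply: (IHk _ _ b p) => //; first lia.
  - by rewrite bp'; lia.
  - exact: adj_sym.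
  - exact: bu'.1.
  - lia.
have zw : D z w = i.
  have := gdist_adj_cases z wq; have := gdist_adj_cases z wu; lia.
have [x [zx xw xb]] : exists x, [/\ adj z x, D x w = i.-1 & D x b = (D z b).-1].
  by apply: IH => //; lia.
by exists x; split=> //=; apply: (extend w) => //; apply: adj_sym.
Qed.

(** Geodesics from [z] to [v] through [a] and through [b] form a closed walk of length [2k + 2]. For
    [k > 1] it is not an isometric cycle, so some [p i] and [q j] are closer than along it. If the
    shorter arc passes through [z], [descend] gives a neighbour of [z] nearer to both points,
    otherwise a neighbour of [v]. *)
Lemma quadrangle k : quadrangle_at k.
Proof.
elim/ltn_ind: k => k IH z v a b zv va vb za zb k0.
have [k1|k1] := eqVneq k 1.
  exists z; split; rewrite ?gdistxx ?k1 //; apply: (@adj_gdist _ conn); lia.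
have step u : D z u = k -> exists2 w, adj w u & D z w = k.-1.
  move=> zu; have [|w uw wz] := @gdist_step _ conn k.-1 u z.
    by rewrite gdistC zu prednK.
  by exists w; [apply: adj_sym|rewrite gdistC].
have [p [p0 pk pk1 pd]] := geodesic_through zv va za.
have [q [q0 qk qk1 qd]] := geodesic_through zv vb zb.
have zp i : i <= k.+1 -> D z (p i) = i by move=> lei; rewrite -p0 pd ?subn0.
have zq i : i <= k.+1 -> D z (q i) = i by move=> lei; rewrite -q0 qd ?subn0.
have vp i : i <= k.+1 -> D (p i) v = k.+1 - i by move=> lei; rewrite -pk1 pd.
have vq i : i <= k.+1 -> D (q i) v = k.+1 - i by move=> lei; rewrite -qk1 qd.
have [H|/existsNP[i /existsNP[j /not_implyP[/andP[i0 ik] /not_implyP[/andP[j0 jk] ne]]]]] :=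
  pselect (forall i j, 0 < i <= k -> 0 < j <= k ->
    D (p i) (q j) = minn (i + j) (k.*2.+2 - (i + j))).
  (* The cycle runs up [p] from [z] to [v] and back down [q]. *)
  pose x i := if i <= k.+1 then p i else q (k.*2.+2 - i).
  have xq i : k.+1 <= i -> x i = q (k.*2.+2 - i).
    rewrite /x leq_eqVlt => /predU1P[<-|lt]; last by rewrite leqNgt lt.
    by rewrite leqnn pk1 -qk1; congr q; lia.
  have xp i : i <= k.+1 -> x i = p i by rewrite /x => ->.
  have x0 : x 0 = q 0 by rewrite xp // p0.
  suff : k.*2.+2 = 4 by lia.
  apply: (isometric_nth (conn := conn) iso4 (x := x)); first lia.
    move=> i lti; apply: (@adj_gdist _ conn).
    have [leik|ltki] := leqP i k.
      by rewrite modn_small ?xp ?pd //; lia.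
    have [ei|ni] := eqVneq i.+1 k.*2.+2.
      by rewrite ei modnn x0 xq // gdistC qd //; lia.
    by rewrite modn_small ?xq 1?[D (q _) _]gdistC ?qd //; lia.
  move=> i j /andP[ltij ltj].
  have [jk|kj] := leqP j k.+1; first by rewrite !xp ?pd //; lia.
  have [ki|ik] := leqP k.+1 i.
    by rewrite !xq 1?[D (q _) _]gdistC ?qd //; lia.
  rewrite xp ?(ltnW ik) // xq ?(ltnW kj) //.
  have [->|i0] := posnP i; first by rewrite p0 zq; lia.
  rewrite H; lia.
have lt : D (p i) (q j) < minn (i + j) (k.*2.+2 - (i + j)).
  have := gdist_triangle conn (p i) z (q j); have := gdist_triangle conn (p i) v (q j).
  have -> : D v (q j) = k.+1 - j by rewrite gdistC vq; lia.
  have -> : D (p i) z = i by rewrite gdistC zp; lia.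
  rewrite vp ?zq; lia.
have ak : D (p i) a = k - i by rewrite -pk pd // leqW.
have bk : D (q j) b = k - j by rewrite -qk qd // leqW.
(* In the first case [x] has distance [k - 1] to [a] and [b], and [k] to [v], so the condition for
   [k - 1] with base [x] already gives [w]. *)
have [sm|lg] := leqP (i + j) k.+1.
  have [x [zx xp]] : exists x, [/\ adj z x, D x (p i) = i.-1 & D x (q j) = (D z (q j)).-1].
    by apply: (descend IH); rewrite ?zp ?zq // ?[D (q j) _]gdistC; lia.
  rewrite zq; last lia.
  move=> xq; have zx1 := Dadj zx.
  have t1 := gdist_triangle conn x (p i) a; have t2 := gdist_triangle conn x (q j) b.
  have t3 := gdist_triangle conn z x a; have t4 := gdist_triangle conn z x b.
  have t5 := gdist_triangle conn z x v; have t6 := gdist_triangle conn x a v.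
  have av := Dadj (adj_sym va).
  have [w [wa wb xw]] : exists w, [/\ adj w a, adj w b & D x w = k.-1.-1].
    apply: (IH k.-1 _ x v) => //; lia.
  exists w; split=> //; have := gdist_triangle conn z x w.
  have := gdist_adj_cases z wa; lia.
have [x [vx xp]] : exists x, [/\ adj v x, D x (p i) = (k.+1 - i).-1 &
    D x (q j) = (D v (q j)).-1].
  have vj : D v (q j) = k.+1 - j by rewrite gdistC vq; lia.
  have vi : D v (p i) = k.+1 - i by rewrite gdistC vp; lia.
  by apply: (descend IH); rewrite ?vj // ?[D (q j) _]gdistC; lia.
have -> : D v (q j) = k.+1 - j by rewrite gdistC vq; lia.
move=> xq.
have zx : D z x = k.
  have := gdist_triangle conn z (p i) x; rewrite zp; last lia.
  by have := gdist_adj_cases z vx; rewrite [D (p i) x]gdistC; lia.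
(* Base [p i] yields a common lower neighbour of [a] and [x], base [q j] one of [b] and [x]. In the
   degenerate case [l = k] the vertices [x], [y] and [c] coincide and any lower neighbour serves. *)
have side c y l : 0 < l <= k -> D z y = l -> D y v = k.+1 - l -> D y c = k - l ->
    adj v c -> D x y = (k.+1 - l).-1 -> D z c = k ->
    exists w, [/\ adj w c, adj w x & D z w = k.-1].
  move=> /andP[l0 lk] zy yv yc vc xy zc.
  have [kl|kl] := posnP (k - l).
    have cy : y = c by apply: (@gdist_eq0 _ conn); rewrite yc kl.
    have xy' : x = y by apply: (@gdist_eq0 _ conn); lia.
    by have [w wx zw] := step x zx; exists w; rewrite -cy -xy'.
  have [w [wc wx yw]] : exists w, [/\ adj w c, adj w x & D y w = (k - l).-1].
    apply: (IH (k - l) _ y v) => //; rewrite ?[D y x]gdistC; lia.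
  exists w; split=> //; have := gdist_triangle conn z y w.
  have := gdist_adj_cases z wc; lia.
have [w1 [w1a w1x zw1]] : exists w, [/\ adj w a, adj w x & D z w = k.-1].
  by apply: (side a (p i) i); rewrite ?zp ?vp ?i0 //; lia.
have [w2 [w2b w2x zw2]] : exists w, [/\ adj w b, adj w x & D z w = k.-1].
  by apply: (side b (q j) j); rewrite ?zq ?vq ?j0 //; lia.
have [y [yw1 yw2 zy]] : exists y, [/\ adj y w1, adj y w2 & D z y = k.-1.-1].
  by apply: (IH k.-1 _ z x); rewrite ?prednK //; try (exact: adj_sym); lia.
(* The hexagon [a, v, b, w2, y, w1] has no diagonal from [v] to [y], by the distances to [z]; each
   other diagonal or coincidence either contradicts these distances or provides a common lower
   neighbour of [a] and [b]. *)
apply: contrapT => no.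
have diff u u' : D z u <> D z u' -> u <> u' by move=> ne' e; apply: ne'; rewrite e.
apply: (@hexagon a v b w2 y w1) => //.
- exact: adj_sym.
- exact: adj_sym.
- exact: adj_sym.
- by move=> ab; have [w wa zw] := step a za; apply: no; exists w; rewrite -ab.
- by apply: diff; lia.
- by apply: diff; lia.
- by move=> e; apply: no; exists w1; rewrite -{2}e.
- by apply: diff; lia.
- by apply: diff; lia.
- by move=> /adj_sym aw2; apply: no; exists w2.
- by move=> /(gdist_adj_cases z); lia.
- by move=> /adj_sym bw1; apply: no; exists w1.
Qed.

(* Any three members of [s] and the corresponding pairwise common lower
   neighbours would span an isometric hexagon. *)
Lemma common_lower_neighbour z v n (s : seq {classic (vertex G)}) : D z v = n.+2 ->
    (forall d : {classic (vertex G)}, d \in s -> adj v d /\ D z d = n.+1) ->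
  exists2 u, D z u = n & forall d : {classic (vertex G)}, d \in s -> adj u d.
Proof.
move=> zv; elim: s => [|d s IH] sv.
  have zv' : D v z = n.+2 by rewrite gdistC.
  have [w _ wz] := gdist_step zv'; have [u _ uz] := gdist_step wz.
  by exists u; rewrite // gdistC.
have [|u zu us] := IH; first by move=> e es; apply: sv; rewrite inE es orbT.
have [vd zd] : adj v d /\ D z d = n.+1 by apply: sv; rewrite inE eqxx.
have [ud|ud] := pselect (adj u d).
  by exists u => // e; rewrite inE => /predU1P[->|] //; apply: us.
suff [w zw [wd ws]] : exists2 w, D z w = n & adj w d /\
    forall e : {classic (vertex G)}, e \in s -> adj w e.
  by exists w => // e; rewrite inE => /predU1P[->|] //; apply: ws.
(* The replacement for [u] is built by induction on lists [t] contained in [s], always adjacent to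
   [d]; meanwhile [u] stays available for all of [s]. *)
have {IH} : {subset s <= s} by [].
elim: {-2}s => [|e t IH] ts.
  have zd' : D d z = n.+1 by rewrite gdistC.
  have [w dw wz] := gdist_step zd'.
  by exists w; rewrite 1?gdistC //; split=> //; apply: adj_sym.
have [|w zw [wd wt]] := IH; first by move=> e' et; apply: ts; rewrite inE et orbT.
have es : e \in s by apply: ts; rewrite inE eqxx.
have [ve ze] : adj v e /\ D z e = n.+1 by apply: sv; rewrite inE es orbT.
have [we|we] := pselect (adj w e).
  by exists w => //; split=> // e'; rewrite inE => /predU1P[->|] //; apply: wt.
have [w' [w'd w'e zw']] : exists w', [/\ adj w' d, adj w' e & D z w' = n].
  exact: (@quadrangle n.+1 z v).
exists w' => //; split=> // e'; rewrite inE => /predU1P[->//|e't].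
have e's : e' \in s by apply: ts; rewrite inE e't orbT.
have [ve' ze'] : adj v e' /\ D z e' = n.+1 by apply: sv; rewrite inE e's orbT.
(* The hexagon [e', u, e, w', d, w] has no long diagonal: [u] misses [d], [w] misses [e], and [w']
   would miss [e']. *)
apply: contrapT => w'e'; have ue := us _ es; have ue' := us _ e's.
have we' := wt _ e't.
apply: (@hexagon e' u e w' d w) => //.
- exact: adj_sym.
- exact: adj_sym.
- exact: adj_sym.
- by move=> ee; apply: we; rewrite -ee.
- by move=> uw'; apply: ud; rewrite uw'.
- by move=> ed; apply: ud; rewrite -ed.
- by move=> ww'; apply: w'e'; rewrite ww'.
- by move=> de; apply: ud; rewrite de.
- by move=> wu; apply: ud; rewrite -wu.
- by move=> /adj_sym.
- by move=> /adj_sym.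
Qed.

End Quadrangle.

(** * Homotopies of order complexes *)

Section Weights.
Local Open Scope ring_scope.
Variable R : realType.

Definition fsum (T : Type) (F : T -> R) : R := \sum_(x \in [set: {classic T}]) F x.

Lemma fsumE (T : Type) (L : seq {classic T}) (F : T -> R) : uniq L ->
  (forall x : {classic T}, F x != 0 -> x \in L) -> fsum F = \sum_(x <- L) F x.
Proof.
move=> uL FL; rewrite bigfs //; last first.
  by move=> x _; apply: contraNeq => /FL.
by rewrite /fsum (_ : [set` _] = setT) //; apply/seteqP; split.
Qed.

Lemma finite_listP (T : Type) (A : set T) : finite_set A ->
  exists2 L : seq {classic T}, uniq L & forall x : {classic T}, (x \in L) <-> A x.
Proof.
move=> finA; exists (enum_fset (@fset_set {classic T} A)); first exact: fset_uniq.
move=> x; split=> [|Ax].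
  by move=> xA; apply/set_mem; rewrite -(@in_fset_set {classic T} A finA).
by apply: (_ : x \in @fset_set {classic T} A); rewrite in_fset_set // mem_set.
Qed.

Lemma finite_subsets (T : Type) (A : set T) : finite_set A -> finite_set [set B | B `<=` A].
Proof.
move=> finA; pose F := @fset_set {classic T} A.
apply: (@sub_finite_set _ _ ((fun X : {fset {classic T}} => [set` X]) @` [set` fpowerset F])).
  move=> B /= BA; have finB : finite_set B by apply: sub_finite_set finA.
  exists (@fset_set {classic T} B); last by rewrite fset_setK.
  rewrite /= fpowersetE; apply/fsubsetP => x; rewrite !in_fset_set // !inE.
  exact: BA.
by apply: finite_image; apply: finite_fset.
Qed.

Section Prism.
Variables T U : Type.
Implicit Types (t : T -> R) (f g : T -> U) (o : T -> T -> Prop) (s : R).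

Definition above o t (x : T) : R := fsum (fun y => `[< o x y /\ x <> y >]%:R * t y).

(* At time [s] the top part of total mass [s] of the chain carrying [t] has been
   moved; this is its share at [x]. *)
Definition moved o t s (x : T) : R := Num.min (t x) (Num.max 0 (s - above o t x)).

(* Moving the top of the chain first keeps the support a chain as soon as
   [f x <= g x]. *)
Definition prism o f g t s (z : U) : R :=
  fsum (fun x => `[< g x = z >]%:R * moved o t s x +
                 `[< f x = z >]%:R * (t x - moved o t s x)).

Definition pushw f t (z : U) : R := fsum (fun x => `[< f x = z >]%:R * t x).

(** The increments of successive prisms are added up. An increment vanishes before its stage begins,
    and once the stage is over it telescopes with its predecessors. So one formula covers all times,
    and continuity needs no case distinction. *)
Definition fence (o : nat -> T -> T -> Prop) (phi : nat -> T -> U) t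
    (tau : nat -> R) (N : nat) (z : U) : R :=
  pushw (phi 0%N) t z +
  \sum_(n < N) (prism (o n) (phi n) (phi n.+1) t (tau n) z - pushw (phi n) t z).

End Prism.

(* A point, of total mass [M] instead of 1, of the order complex of a relation. *)
Definition weight (T : Type) (o : T -> T -> Prop) (M : R) (t : T -> R) : Prop :=
  [/\ finite_set [set x | t x != 0],
      (forall x y, t x != 0 -> t y != 0 -> o x y \/ o y x),
      (forall x, 0 <= t x) & fsum t = M].

Section PrismWeight.
Variables T U : Type.
Implicit Types (f g : T -> U).
Variables (o : T -> T -> Prop) (M : R) (t : T -> R).
Hypothesis tw : weight o M t.
Hypothesis o_trans : forall x y z, o x y -> o y z -> o x z.
Hypothesis o_anti : forall x y, o x y -> o y x -> x = y.

Let t0 x : 0 <= t x. Proof. by case: tw. Qed.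

Let listP : exists2 L : seq {classic T}, uniq L &
  forall x : {classic T}, (x \in L) <-> t x != 0.
Proof. by apply: finite_listP; case: tw. Qed.

Lemma indic_ge0 (P : Prop) (a : R) : 0 <= a -> 0 <= `[< P >]%:R * a.
Proof. by move=> a0; rewrite mulr_ge0 ?ler0n. Qed.

Lemma above_ge0 x : 0 <= above o t x.
Proof. by apply: fsumr_ge0 => y _; apply: indic_ge0. Qed.

Lemma moved_ge0 s x : 0 <= moved o t s x.
Proof. by rewrite /moved le_min t0 le_max lexx. Qed.

Lemma moved_le s x : moved o t s x <= t x.
Proof. by rewrite /moved ge_min lexx. Qed.

Lemma indic_neq0 (P : Prop) (a : R) : `[< P >]%:R * a != 0 -> a != 0.
Proof. by apply: contraNneq => ->; rewrite mulr0. Qed.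

(** Consequence for [moved]: as soon as [x] begins to move, every element of the support strictly
    above [x] has been moved entirely. *)
Lemma above_step x y : o x y -> x <> y -> above o t y + t y <= above o t x.
Proof.
move=> oxy xy; have [L uL LP] := listP.
have ty : t y = \sum_(z <- L) `[< z = y >]%:R * t z.
  rewrite -(fsumE (F := fun z => `[< z = y >]%:R * t z)) //; last first.
    by move=> z /indic_neq0; apply: (LP z).2.
  rewrite (@fsumE _ [:: y]) //; last first.
    move=> z; rewrite inE; apply: contraR => /eqP zy.
    by rewrite asboolF ?mul0r.
  by rewrite big_seq1 asboolT // mul1r.
rewrite /above !(fsumE uL); try by move=> z /indic_neq0; apply: (LP z).2.
rewrite ty -big_split /=; apply: ler_sum => z _; rewrite -mulrDl.
apply: ler_wpM2r => //; rewrite -natrD ler_nat.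
case: asboolP => [[oyz yz]|_]; case: asboolP => [zy|_] //=.
- by case: yz.
- rewrite asboolT //; split; first exact: o_trans oyz.
  by move=> xz; apply: xy; apply: o_anti; rewrite // xz.
- by rewrite zy asboolT.
Qed.

Lemma above_total x : above o t x + t x <= M.
Proof.
have [L uL LP] := listP; have [_ _ _ <-] := tw.
have tx : t x = \sum_(z <- L) `[< z = x >]%:R * t z.
  rewrite -(fsumE (F := fun z => `[< z = x >]%:R * t z)) //; last first.
    by move=> z /indic_neq0; apply: (LP z).2.
  rewrite (@fsumE _ [:: x]) //; last first.
    move=> z; rewrite inE; apply: contraR => /eqP zx.
    by rewrite asboolF ?mul0r.
  by rewrite big_seq1 asboolT // mul1r.
rewrite /above !(fsumE uL);
  try by [move=> z; apply: (LP z).2|move=> z /indic_neq0; apply: (LP z).2].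
rewrite tx -big_split /=; apply: ler_sum => z _; rewrite -mulrDl.
rewrite -[leRHS]mul1r; apply: ler_wpM2r => //; rewrite -natrD (ler_nat _ _ 1%N).
by case: asboolP => [[oxz xz]|_]; case: asboolP => [zx|_] //=; case: xz.
Qed.

Lemma moved_le0 s x : s <= 0 -> moved o t s x = 0.
Proof.
move=> s0; rewrite /moved max_l ?subr_le0 ?(le_trans s0) ?above_ge0 //.
by rewrite min_r.
Qed.

Lemma moved_ge s x : M <= s -> moved o t s x = t x.
Proof.
move=> Ms; rewrite /moved min_l // le_max; apply/orP; right.
by rewrite lerBrDl (le_trans (above_total x)).
Qed.

Lemma prism_le0 f g s z : s <= 0 -> prism o f g t s z = pushw f t z.
Proof.
move=> s0; rewrite /prism /pushw; congr fsum; apply/funext => x.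
by rewrite moved_le0 // mulr0 add0r subr0.
Qed.

Lemma prism_ge f g s z : M <= s -> prism o f g t s z = pushw g t z.
Proof.
move=> s0; rewrite /prism /pushw; congr fsum; apply/funext => x.
by rewrite moved_ge // subrr mulr0 addr0.
Qed.

Lemma prism_ge0 f g s z : 0 <= prism o f g t s z.
Proof.
apply: fsumr_ge0 => x _; rewrite addr_ge0 ?indic_ge0 ?moved_ge0 //.
by rewrite subr_ge0 moved_le.
Qed.

Let term_neq0 f g s z x : `[< g x = z >]%:R * moved o t s x +
    `[< f x = z >]%:R * (t x - moved o t s x) != 0 -> t x != 0.
Proof.
apply: contraNneq => tx; have := moved_ge0 s x; have := moved_le s x.
rewrite tx => l1 l2; have -> : moved o t s x = 0 by apply/eqP; rewrite eq_le l1 l2.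
by rewrite subrr !mulr0 addr0.
Qed.

Lemma prism_neq0 f g s z : prism o f g t s z != 0 -> exists2 x, t x != 0 &
  (g x = z /\ 0 < moved o t s x) \/ (f x = z /\ moved o t s x < t x).
Proof.
apply: contraNP => no; rewrite /prism /fsum fsbig1 //= => x _.
have [tx|tx] := eqVneq (t x) 0.
  by apply/eqP; apply: contraT => /term_neq0; rewrite tx eqxx.
have -> : `[< g x = z >]%:R * moved o t s x = 0 :> R.
  case: asboolP => [gz|_]; last by rewrite mul0r.
  have -> : moved o t s x = 0; last by rewrite mulr0.
  apply/eqP; rewrite eq_le moved_ge0 andbT leNgt.
  by apply/negP => m0; apply: no; exists x => //; left.
case: asboolP => [fz|_]; last by rewrite mul0r addr0.
have -> : moved o t s x = t x; last by rewrite subrr mulr0 addr0.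
apply/eqP; rewrite eq_le moved_le leNgt.
by apply/negP => m0; apply: no; exists x => //; right.
Qed.

Lemma prism_finite f g s : finite_set [set z | prism o f g t s z != 0].
Proof.
have fin : finite_set [set x | t x != 0] by case: tw.
apply: (sub_finite_set _ (_ : finite_set
  (f @` [set x | t x != 0] `|` g @` [set x | t x != 0]))).
  by move=> z /= /prism_neq0[x tx [[<- _]|[<- _]]]; [right|left]; exists x.
by rewrite finite_setU; split; apply: finite_image.
Qed.

Lemma indic_sum (V : Type) (L : seq {classic V}) (v : V) : uniq L ->
  ((v : {classic V}) \in L) -> \sum_(z <- L) `[< v = z >]%:R = 1 :> R.
Proof.
move=> uL vL; rewrite (bigD1_seq (v : {classic V})) //= asboolT // big1 ?addr0 //.
by move=> z /eqP zv; rewrite asboolF // => /esym.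
Qed.

Lemma prism_sum f g s : fsum (prism o f g t s) = M.
Proof.
have [L uL LP] := listP.
have fin : finite_set [set x | t x != 0] by case: tw.
have finA : finite_set (f @` [set x | t x != 0] `|` g @` [set x | t x != 0]).
  by rewrite finite_setU; split; apply: finite_image.
have [K uK KP] := finite_listP finA.
rewrite (fsumE uK); last first.
  by move=> z /prism_neq0[x tx [[<- _]|[<- _]]]; apply/KP; [right|left]; exists x.
transitivity (\sum_(z <- K) \sum_(x <- L) (`[< g x = z >]%:R * moved o t s x +
                 `[< f x = z >]%:R * (t x - moved o t s x))).
  by apply: eq_bigr => z _; rewrite /prism (fsumE uL) // => x /term_neq0; apply: (LP x).2.
have [_ _ _ <-] := tw; rewrite (fsumE uL); last by move=> x; apply: (LP x).2.
rewrite exchange_big /=; apply: eq_big_seq => x /LP tx.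
have fK : (f x : {classic U}) \in K by apply/KP; left; exists x.
have gK : (g x : {classic U}) \in K by apply/KP; right; exists x.
by rewrite big_split /= -!mulr_suml !indic_sum // !mul1r addrC subrK.
Qed.

(** The critical pairs of the support are [f y] and [g x]. If [y] is below [x], then [f y], [g y],
    [g x] increase. If [x] is strictly below [y], they might be incomparable, but by [above_step]
    they do not occur together: [x] has begun to move only after [y] has finished. Monotonicity is
    asked only on the support of [t], because the maps used for the retractions are monotone only on
    links. *)
Lemma prism_weight f g s (o' : U -> U -> Prop) :
    (forall x y z, o' x y -> o' y z -> o' x z) ->
    (forall x y, t x != 0 -> t y != 0 -> o x y -> o' (f x) (f y) /\ o' (g x) (g y)) ->
    (forall x, t x != 0 -> o' (f x) (g x)) ->
  weight o' M (prism o f g t s).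
Proof.
move=> o'_trans mono fg; split; first exact: prism_finite; last exact: prism_sum.
  have tot x y : t x != 0 -> t y != 0 -> o x y \/ o y x by case: tw => _ + _ _; apply.
  have cross x y : t x != 0 -> t y != 0 -> 0 < moved o t s x -> moved o t s y < t y ->
      o' (f y) (g x).
    move=> tx ty mx my; have [<-|xy] := pselect (x = y); first exact: fg.
    have [oxy|oyx] := tot x y tx ty; last first.
      exact: o'_trans (fg _ ty) (mono _ _ ty tx oyx).2.
    have := above_step oxy xy; move: mx my; rewrite /moved lt_min lt_max ltxx /=.
    move=> /andP[_]; rewrite subr_gt0 gt_min ltxx /= gt_max => sx /andP[_].
    rewrite ltrBlDl => sy; have := lt_trans sx sy.
    by move=> /lt_le_trans/[apply]; rewrite ltxx.
  move=> z1 z2 /prism_neq0[x tx Hx] /prism_neq0[y ty Hy].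
  case: Hx Hy => -[<- mx] [[<- my]|[<- my]].
  - by have [/mono|/mono] := tot x y tx ty => -[]//; [left|right].
  - by right; apply: cross.
  - by left; apply: cross.
  - by have [/mono|/mono] := tot x y tx ty => -[]//; [left|right].
by move=> z; apply: prism_ge0.
Qed.

End PrismWeight.
End Weights.

Section Fence.
Local Open Scope ring_scope.
Variables (R : realType) (T U : Type) (M : R) (t : T -> R).
Variables (o : nat -> T -> T -> Prop) (phi : nat -> T -> U).
Hypothesis tw : forall n, weight (o n) M t.

Lemma fence0 tau z : fence o phi t tau 0 z = pushw (phi 0%N) t z.
Proof. by rewrite /fence big_ord0 addr0. Qed.

Lemma fenceS tau N z : fence o phi t tau N.+1 z = fence o phi t tau N z +
  (prism (o N) (phi N) (phi N.+1) t (tau N) z - pushw (phi N) t z).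
Proof. by rewrite /fence big_ord_recr /= addrA. Qed.

Lemma fence_ge tau N z : (forall n, (n < N)%N -> M <= tau n) ->
  fence o phi t tau N z = pushw (phi N) t z.
Proof.
elim: N => [|N IH] H; first exact: fence0.
rewrite fenceS IH => [|n nN]; last by apply: H; rewrite ltnW.
by rewrite (prism_ge (tw N)) ?H // addrC subrK.
Qed.

(* When the stages are run one after the other, at most one of them is in
   progress. *)
Lemma fence_prism tau N :
    (forall n m, (n < m < N.+1)%N -> 0 < tau m -> M <= tau n) ->
  exists2 n, (n < N.+1)%N &
    fence o phi t tau N.+1 = prism (o n) (phi n) (phi n.+1) t (tau n).
Proof.
elim: N => [|N IH] H.
  by exists 0%N => //; apply/funext => z; rewrite fenceS fence0 addrC subrK.
have [le0|gt0] := leP (tau N.+1) 0.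
  have [|n nN E] := IH; first by move=> n m /andP[nm mN]; apply: H; rewrite nm ltnW.
  exists n; first exact: ltnW.
  by apply/funext => z; rewrite fenceS (prism_le0 (tw N.+1)) // subrr addr0 E.
exists N.+1 => //; apply/funext => z.
rewrite fenceS fence_ge ?[X in _ = X]addrC 1?addrC ?subrK // => n nN.
by apply: H gt0; rewrite nN ltnSn.
Qed.

End Fence.

Section Push.
Local Open Scope ring_scope.
Variables (R : realType) (T : Type) (t : T -> R).

Lemma pushw_id (phi : T -> T) : (forall x, t x != 0 -> phi x = x) -> pushw phi t = t.
Proof.
move=> phiE; apply/funext => z; rewrite /pushw (@fsumE _ _ [:: z]) //.
  rewrite big_seq1; have [->|tz] := eqVneq (t z) 0; first by rewrite mulr0.
  by rewrite asboolT ?mul1r // phiE.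
move=> x; rewrite inE; apply: contraR => /eqP xz.
have [->|tx] := eqVneq (t x) 0; first by rewrite mulr0.
by rewrite asboolF ?mul0r // phiE.
Qed.

Lemma pushw_cst (U : Type) (phi : T -> U) (c z : U) :
  finite_set [set x | t x != 0] ->
  (forall x, t x != 0 -> phi x = c) -> pushw phi t z = `[< c = z >]%:R * fsum t.
Proof.
move=> /finite_listP[L uL LP] phiE; rewrite /pushw !(fsumE uL).
- rewrite mulr_sumr; apply: eq_big_seq => x /LP tx; by rewrite phiE.
- by move=> x; apply: (LP x).2.
- by move=> x /indic_neq0; apply: (LP x).2.
Qed.

Lemma pushw_neq0 (U : Type) (phi : T -> U) z : pushw phi t z != 0 ->
  exists2 x, phi x = z & t x != 0.
Proof.
apply: contraNP => no; rewrite /pushw /fsum fsbig1 //= => x _.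
case: asboolP => [xz|_]; last by rewrite mul0r.
have [->|tx] := eqVneq (t x) 0; first by rewrite mulr0.
by case: no; exists x.
Qed.

End Push.

(** * Continuity of prisms and fences *)

Section Continuity.
Local Open Scope ring_scope.
Variables (R : realType) (Y : Type) (F : set_system Y).
Context {FF : Filter F}.

Lemma cvg_minr (a b : Y -> R) (a0 b0 : R) : a @ F --> a0 -> b @ F --> b0 ->
  Num.min (a y) (b y) @[y --> F] --> Num.min a0 b0.
Proof.
move=> ca cb; rewrite minr_absE; under eq_cvg do rewrite minr_absE.
apply: cvgM; last exact: cvg_cst.
by apply: cvgB; [apply: cvgD|apply: cvg_norm; apply: cvgB].
Qed.

Lemma cvg_maxr (a b : Y -> R) (a0 b0 : R) : a @ F --> a0 -> b @ F --> b0 ->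
  Num.max (a y) (b y) @[y --> F] --> Num.max a0 b0.
Proof.
move=> ca cb; rewrite maxr_absE; under eq_cvg do rewrite maxr_absE.
apply: cvgM; last exact: cvg_cst.
by apply: cvgD; [apply: cvgD|apply: cvg_norm; apply: cvgB].
Qed.

Lemma near_finite (I : Type) (A : set I) (P : I -> Y -> Prop) : finite_set A ->
  (forall i, A i -> \forall y \near F, P i y) ->
  \forall y \near F, forall i, A i -> P i y.
Proof.
move=> /finite_listP[L _ LP] H.
suff : \forall y \near F, forall i : {classic I}, i \in L -> P i y.
  by apply: filterS => y Hy i /LP; apply: Hy.
have {}H (i : {classic I}) : i \in L -> \forall y \near F, P i y by move=> /LP/H.
elim: L {LP} H => [|i L IH] H; first exact: nearW.
apply: filterS2 (H i (mem_head _ _)) (IH _) => [y Pi PL j|j jL].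
  by rewrite inE => /predU1P[->|/PL].
by apply: H; rewrite inE jL orbT.
Qed.

Lemma fsum_cvg (T : Type) (A : set T) (h : Y -> T -> R) (h0 : T -> R) :
    finite_set A ->
    (\forall y \near F, forall x, h y x != 0 -> A x) ->
    (forall x, h0 x != 0 -> A x) ->
    (forall x, h y x @[y --> F] --> h0 x) ->
  fsum (h y) @[y --> F] --> fsum h0.
Proof.
move=> /finite_listP[L uL LP] hA h0A hh; rewrite (fsumE uL); last first.
  by move=> x /h0A/(LP x).2.
have E : \forall y \near F, \sum_(x <- L) h y x = fsum (h y).
  by apply: filterS hA => y hy; rewrite (fsumE uL) // => x /hy/(LP x).2.
apply: cvg_trans (near_eq_cvg E) _.
elim: L {uL LP E} => [|x L IH].
  by rewrite big_nil; under eq_cvg do rewrite big_nil; apply: cvg_cst.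
rewrite big_cons; under eq_cvg do rewrite big_cons.
by apply: cvgD => //; apply: hh.
Qed.

Section Prism.
Variables (T U : Type) (A : set T) (w : Y -> T -> R) (w0 : T -> R).
Hypothesis finA : finite_set A.
Hypothesis wA : \forall y \near F, forall x, w y x != 0 -> A x.
Hypothesis w0A : forall x, w0 x != 0 -> A x.
Hypothesis ww : forall x, w y x @[y --> F] --> w0 x.
Hypothesis w_ge0 : forall y x, 0 <= w y x.
Hypothesis w0_ge0 : forall x, 0 <= w0 x.

Lemma indic_cvg (P : Prop) (h : Y -> R) (h0 : R) : h @ F --> h0 ->
  `[< P >]%:R * h y @[y --> F] --> `[< P >]%:R * h0.
Proof. by move=> hh; apply: cvgM => //; apply: cvg_cst. Qed.

Lemma above_cvg o x : above o (w y) x @[y --> F] --> above o w0 x.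
Proof.
apply: (fsum_cvg finA).
- by apply: filterS wA => y wy z /indic_neq0/wy.
- by move=> z /indic_neq0/w0A.
- by move=> z; apply: indic_cvg.
Qed.

Lemma moved_cvg o (s : Y -> R) s0 x : s @ F --> s0 ->
  moved o (w y) (s y) x @[y --> F] --> moved o w0 s0 x.
Proof.
move=> ss; apply: cvg_minr => //; apply: cvg_maxr; first exact: cvg_cst.
by apply: cvgB => //; apply: above_cvg.
Qed.

Lemma pushw_cvg (phi : T -> U) z : pushw phi (w y) z @[y --> F] --> pushw phi w0 z.
Proof.
apply: (fsum_cvg finA).
- by apply: filterS wA => y wy x /indic_neq0/wy.
- by move=> x /indic_neq0/w0A.
- by move=> x; apply: indic_cvg.
Qed.

Lemma prism_cvg o (f g : T -> U) (s : Y -> R) s0 z : s @ F --> s0 ->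
  prism o f g (w y) (s y) z @[y --> F] --> prism o f g w0 s0 z.
Proof.
move=> ss.
have supp (v : T -> R) r x : (forall x, 0 <= v x) ->
    `[< g x = z >]%:R * moved o v r x + `[< f x = z >]%:R * (v x - moved o v r x) != 0 ->
    v x != 0.
  move=> v0; apply: contraNneq => vx; rewrite vx.
  have -> : moved o v r x = 0 by rewrite /moved vx min_l // le_max lexx.
  by rewrite subrr !mulr0 addr0.
apply: (fsum_cvg finA).
- by apply: filterS wA => y wy x /supp-/(_ (w_ge0 y))/wy.
- by move=> x /supp-/(_ w0_ge0)/w0A.
- move=> x; apply: cvgD; apply: indic_cvg; first exact: moved_cvg.
  by apply: cvgB => //; apply: moved_cvg.
Qed.

Lemma fence_cvg o (phi : nat -> T -> U) (tau : Y -> nat -> R) tau0 N z :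
    (forall n, tau y n @[y --> F] --> tau0 n) ->
  fence o phi (w y) (tau y) N z @[y --> F] --> fence o phi w0 tau0 N z.
Proof.
move=> tt; elim: N => [|N IH].
  rewrite fence0; under eq_cvg do rewrite fence0; exact: pushw_cvg.
rewrite fenceS; under eq_cvg do rewrite fenceS.
by apply: cvgD => //; apply: cvgB; [apply: prism_cvg|apply: pushw_cvg].
Qed.

End Prism.
End Continuity.

(** * Realizations of locally finite posets *)

Section Realization.
Local Open Scope ring_scope.
Variable R : realType.

Definition comparable (P : cell_poset) (x y : P) : Prop := cell_le x y \/ cell_le y x.

Definition loc_finite (P : cell_poset) : Prop :=
  forall x : P, finite_set [set y | comparable x y].

Definition partial_order (P : cell_poset) : Prop :=
  [/\ forall x : P, cell_le x x,
      forall x y z : P, cell_le x y -> cell_le y z -> cell_le x z &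
      forall x y : P, cell_le x y -> cell_le y x -> x = y].

Lemma realization_inj (P : cell_poset) (t t' : realization R P) :
  coord t = coord t' -> t = t'.
Proof.
case: t t' => [a a1 a2 a3 a4] [b b1 b2 b3 b4] /= ab; subst b.
congr Realization; exact: Prop_irrelevance.
Qed.

Lemma weight_point (P : cell_poset) (w : P -> R) : weight (@cell_le P) 1 w ->
  exists t : realization R P, coord t = w.
Proof. by case=> w1 w2 w3 w4; exists (Realization w1 w2 w3 w4). Qed.

Lemma point_weight (P : cell_poset) (t : realization R P) :
  weight (@cell_le P) 1 (coord t).
Proof. by case: t. Qed.

Lemma point_neq0 (P : cell_poset) (t : realization R P) : exists x, coord t x != 0.
Proof.
apply: contrapT => no; have := coord_sum t.
rewrite fsbig1; first by move=> /esym/eqP; rewrite oner_eq0.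
by move=> x _; apply/eqP; apply: contraT => tx; case: no; exists x.
Qed.

Lemma coord_cvg (P : cell_poset) (t : realization R P) (x : P) :
  coord u x @[u --> t] --> coord t x.
Proof.
have FF := nbhs_filter t; apply/cvgrPdist_lt => e e0.
exists [set u | `|coord t x - coord u x| < e]; split; [|by rewrite /= subrr normr0|by []].
move=> C _ _ u /= ue _; exists (e - `|coord t x - coord u x|); first by rewrite subr_gt0.
move=> u' _ /(_ x); rewrite ltrBrDl distrC [X in _ + X]distrC => lt.
by apply: le_lt_trans lt; rewrite distrC; apply: ler_distD.
Qed.

Lemma near_star (P : cell_poset) (t : realization R P) (x : P) : coord t x != 0 ->
  \forall u \near t, coord u x != 0.
Proof.
move=> tx; have FF := nbhs_filter t.
exact: (cvgr_neq0 (coord t x) (coord_cvg (t := t) (x := x)) tx).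
Qed.

(** An element [x] of the support of [t] eventually lies in the support of [G y], so eventually all
    supports are contained in the finite set of elements comparable to [x]. Hence only finitely many
    chains enter the definition of [weak_open], each with its own radius, and only finitely many
    coordinates have to come close. *)
Lemma realization_cvg (P : cell_poset) (Y : Type) (F : set_system Y) (FF : Filter F)
    (G : Y -> realization R P) (t : realization R P) :
    (forall x : P, cell_le x x) -> loc_finite P ->
    (forall x, coord (G y) x @[y --> F] --> coord t x) ->
  G @ F --> t.
Proof.
move=> refl lf Gt U [V [Vo Vt VU]].
suff : \forall y \near F, V (G y) by apply: filterS => y; apply: VU.
have [x tx] := point_neq0 t.
pose S := [set y | comparable x y]; have finS : finite_set S := lf x.
have tS (u : realization R P) : coord u x != 0 -> forall z, coord u z != 0 -> S z.
  by move=> ux z uz; apply: (coord_chain (r := u)).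
have near_ge C : [set B | B `<=` S] C -> \forall y \near F,
    carried C (G y) -> carried C t -> chain C -> V (G y).
  move=> /= CS; have [Cch|] := pselect (chain C); last by move=> no; apply: nearW.
  have [Ct|] := pselect (carried C t); last by move=> no; apply: nearW.
  have finC : finite_set C by apply: sub_finite_set finS.
  have [e e0 He] := Vo C finC Cch t Vt Ct.
  have : \forall y \near F, forall z, S z -> `|coord t z - coord (G y) z| < e.
    by apply: near_finite => // z _; move/cvgrPdist_lt : (Gt z); apply.
  apply: filterS => y Hy Cy _ _; apply: He => // z.
  have [Sz|Sz] := pselect (S z); first by rewrite distrC Hy.
  have z0 u : carried C u -> coord u z = 0.
    by move=> Cu; apply/eqP; apply: contraT => /Cu/CS.
  by rewrite !z0 // subrr normr0.
have supp : \forall y \near F, forall z, S z -> coord t z != 0 -> coord (G y) z != 0.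
  apply: near_finite => // z _; have [tz|tz] := eqVneq (coord t z) 0.
    exact: nearW.
  have : \forall y \near F, coord (G y) z != 0.
    exact: (cvgr_neq0 (coord t z) (Gt z) tz).
  by apply: filterS.
have all := near_finite (finite_subsets finS) near_ge.
apply: filterS2 supp (all FF) => y Hs Ha.
have Gx : coord (G y) x != 0 by apply: Hs => //; left.
(* The chain to be used is the support of [G y] itself, which by now contains the support of [t]. *)
apply: (Ha [set z | coord (G y) z != 0]) => //=.
- by move=> z /=; apply: tS.
- by move=> z /= tz; apply: Hs => //; apply: tS tz.
- by move=> a b /=; apply: coord_chain.
Qed.

End Realization.

(** * Contractions by zigzags of monotone maps *)

Section Contraction.
Local Open Scope ring_scope.
Variable R : realType.

(* Like [contractible], with a homotopy defined and continuous for all times. *)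
Definition contractible_total (T : topologicalType) : Prop :=
  exists (x0 : T) (H : T * R -> T),
    [/\ continuous H, forall x, H (x, 0) = x & forall x, H (x, 1) = x0].

Lemma contractible_totalW (T : topologicalType) :
  contractible_total T -> contractible R T.
Proof.
move=> [x0 [H [cH H0 H1]]]; exists x0, H; split=> //.
exact: continuous_subspaceT.
Qed.

Section Weight.
Variables (T : Type) (o : T -> T -> Prop).

Lemma weight_comparable (o' : T -> T -> Prop) M (t : T -> R) :
  (forall x y, o x y -> o' x y \/ o' y x) -> weight o M t -> weight o' M t.
Proof.
move=> oo' [t1 t2 t3 t4]; split=> // x y tx ty.
by have [/oo'|/oo'[|]] := t2 x y tx ty; [|right|left].
Qed.

Lemma weight_scale M (t : T -> R) : 0 < M -> weight o M t ->
  weight o 1 (fun x => M^-1 * t x).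
Proof.
move=> M0 [t1 t2 t3 t4].
have nz x : M^-1 * t x != 0 -> t x != 0 by apply: contraNneq => ->; rewrite mulr0.
split.
- by apply: sub_finite_set t1 => x /= /nz.
- by move=> x y /nz tx /nz ty; apply: t2.
- by move=> x; rewrite mulr_ge0 // invr_ge0 ltW.
- have [L uL LP] := finite_listP t1.
  rewrite (fsumE uL); last by move=> x /nz /(LP x).2.
  rewrite -mulr_sumr -(fsumE (F := t) uL); last by move=> x /(LP x).2.
  by rewrite t4 mulVf // gt_eqF.
Qed.

Lemma weight_delta (c : T) : o c c -> weight o 1 (fun x => `[< c = x >]%:R : R).
Proof.
move=> oc; have nz x : `[< c = x >]%:R != 0 :> R -> c = x.
  by case: asboolP => //; rewrite eqxx.
split.
- by apply: (sub_finite_set _ (finite_set1 c)) => x /= /nz.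
- by move=> x y /nz <- /nz <-; left.
- by move=> x; rewrite ler0n.
- rewrite (@fsumE _ _ [:: c]) //; first by rewrite big_seq1 asboolT.
  by move=> x /nz <-; rewrite inE.
Qed.

Lemma prism_same (U : Type) (f g : T -> U) (t : T -> R) s : (forall x, 0 <= t x) ->
  (forall x, t x != 0 -> f x = g x) -> prism o f g t s = pushw f t.
Proof.
move=> t0 fg; apply/funext => z; congr fsum; apply/funext => x.
have [tx|tx] := eqVneq (t x) 0.
  have -> : moved o t s x = 0 by rewrite /moved tx min_l // le_max lexx.
  by rewrite tx subrr !mulr0 addr0.
by rewrite -fg // -mulrDr addrC subrK.
Qed.

End Weight.

(** Flipping the order at odd stages turns a zigzag into a sequence of increasing steps, so one form
    of [prism_weight] suffices. Comparability, and with it [weight], is insensitive to the flip. *)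
Definition alternate (T : Type) (o : T -> T -> Prop) (n : nat) : T -> T -> Prop :=
  if odd n then fun x y => o y x else o.

Section Alternate.
Variables (T : Type) (o : T -> T -> Prop).
Hypothesis o_trans : forall x y z, o x y -> o y z -> o x z.
Hypothesis o_anti : forall x y, o x y -> o y x -> x = y.

Lemma alternate_trans n x y z :
  alternate o n x y -> alternate o n y z -> alternate o n x z.
Proof. by rewrite /alternate; case: odd => H1 H2; [apply: o_trans H1|apply: o_trans H2]. Qed.

Lemma alternate_anti n x y : alternate o n x y -> alternate o n y x -> x = y.
Proof. by rewrite /alternate; case: odd => H1 H2; apply: o_anti. Qed.

Lemma alternate_weight n M (t : T -> R) : weight o M t <-> weight (alternate o n) M t.
Proof.
by split; apply: weight_comparable => x y; rewrite /alternate; case: odd; auto.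
Qed.

End Alternate.

Section Zigzag.
Variables (Q : cell_poset) (phi : nat -> Q -> Q) (c : Q).
Hypothesis Qpo : partial_order Q.
Hypothesis Qlf : loc_finite Q.
Hypothesis phi_mono : forall n x y, cell_le x y -> cell_le (phi n x) (phi n y).
Hypothesis phi_zigzag : forall n x, alternate (@cell_le Q) n (phi n x) (phi n.+1 x).
Hypothesis phi0 : forall x, phi 0%N x = c.
Hypothesis phi_id : forall x, exists N, forall n, (N <= n)%N -> phi n x = x.

Let le := @cell_le Q.
Let le_trans' : forall x y z, le x y -> le y z -> le x z. Proof. by case: Qpo. Qed.
Let le_anti' : forall x y, le x y -> le y x -> x = y. Proof. by case: Qpo. Qed.

(* Stage [n] runs backwards during the interval [[1/(n+2), 1/(n+1)]]. *)
Let tau (s : R) (n : nat) : R := (1 - n.+1%:R * s) * n.+2%:R.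

Let tau_seq s n m : (n < m)%N -> 0 < tau s m -> 1 <= tau s n.
Proof.
move=> nm; rewrite /tau pmulr_lgt0 ?ltr0n // subr_gt0 => ms.
have n2 : n.+2%:R != 0 :> R by rewrite pnatr_eq0.
have [s0|s0] := leP s 0.
  rewrite -[leLHS]mulr1; apply: ler_pM => //; last by rewrite ler1n.
  by rewrite lerBrDl gerDr // mulr_ge0_le0.
have lt : n.+2%:R * s < 1.
  apply: le_lt_trans ms; rewrite ler_wpM2r ?(ltW s0) // ler_nat.
  exact: nm.
have -> : n.+1%:R = n.+2%:R - 1 :> R by rewrite -[n.+2]addn1 natrD addrK.
rewrite -subr_ge0 (_ : _ - 1 = (n.+2%:R - 1) * (1 - n.+2%:R * s)); last by ring.
by rewrite mulr_ge0 ?subr_ge0 ?ler1n // ltW.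
Qed.

Let fence' (t : realization R Q) s N := fence (alternate le) phi (coord t) (tau s) N.

Let valid (t : realization R Q) N :=
  forall x, coord t x != 0 -> forall n, (N <= n)%N -> phi n x = x.

Let alt_weight (t : realization R Q) n : weight (alternate le n) 1 (coord t).
Proof. exact: (alternate_weight le n 1 (coord t)).1 (point_weight t). Qed.

Let finite_valid (A : set Q) : finite_set A ->
  exists N, forall x, A x -> forall n, (N <= n)%N -> phi n x = x.
Proof.
move=> finA.
have [|N _ HN] := @near_finite nat \oo _ Q A (fun x n => phi n x = x) finA.
  by move=> x _; have [N HN] := phi_id x; exists N.
by exists N => x Ax n Nn; apply: HN.
Qed.

Let fence_stable t s N N' : valid t N -> (N <= N')%N -> fence' t s N' = fence' t s N.
Proof.
move=> vN; elim: N' => [|N' IH]; first by rewrite leqn0 => /eqP ->.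
rewrite leq_eqVlt => /predU1P[->//|]; rewrite ltnS => leN.
rewrite -IH //; apply/funext => z; rewrite /fence' fenceS prism_same.
- by rewrite subrr addr0.
- by have [] := point_weight t.
- by move=> x tx; rewrite !(vN x tx) // (leq_trans leN).
Qed.

(** At least one stage is required by [fence_prism], hence [N.+1]. *)
Let fence_point t s N : exists u : realization R Q, coord u = fence' t s N.+1.
Proof.
have tw := alt_weight t.
have [|n _ E] := fence_prism phi tw (tau := tau s) (N := N).
  by move=> n m /andP[nm _]; apply: tau_seq.
apply: weight_point; rewrite /fence' E; apply: (alternate_weight le n _ _).2.
apply: (prism_weight (tw n) (alternate_trans le_trans' (n := n))
  (alternate_anti le_anti' (n := n)) _ (o' := alternate le n)).
- exact: alternate_trans.
- by move=> x y _ _; rewrite /alternate; case: odd => xy; split; apply: phi_mono.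
- by move=> x _; apply: phi_zigzag.
Qed.

(** Since [phi n] fixes the finite support of a point for large [n], only finitely many stages
    affect this point, and by local finiteness one bound works near it. At time 0 every stage is
    complete, which leaves the identity; at time 1 none has begun, which leaves the constant
    [phi 0]. *)
Lemma zigzag_contractible : contractible_total (realization R Q).
Proof.
have /choice[H HP] : forall p : realization R Q * R, exists u : realization R Q,
    forall N, valid p.1 N -> coord u = fence' p.1 p.2 N.+1.
  move=> [t s]; have [t1 _ _ _] := point_weight t; have [N0 v0] := finite_valid t1.
  have [u uE] := fence_point t s N0; exists u => N vN /=.
  have v0' : valid t N0 by move=> x tx; apply: v0.
  rewrite uE (fence_stable s v0' (leqnSn N0)) (fence_stable s vN (leqnSn N)).
  by rewrite -(fence_stable s v0' (leq_maxl N0 N)) (fence_stable s vN (leq_maxr N0 N)).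
have ex (t : realization R Q) : exists N, valid t N.
  have [t1 _ _ _] := point_weight t; have [N HN] := finite_valid t1.
  by exists N => x tx; apply: HN.
have cE t z : pushw (phi 0%N) (coord t) z = `[< c = z >]%:R.
  have [t1 _ _ t4] := point_weight t.
  by rewrite (pushw_cst (c := c)) // t4 mulr1.
have [x0 x0E] : exists x0 : realization R Q, coord x0 = fun z => `[< c = z >]%:R.
  by apply/weight_point/weight_delta; case: Qpo.
exists x0, H; split.
- move=> [t s]; have [refl _ _] := Qpo.
  apply: (realization_cvg (nbhs_filter (t, s))) => // z.
  have [x tx] := point_neq0 t; have [N vN] := finite_valid (Qlf x).
  have star : \forall p \near (t, s), forall y, coord p.1 y != 0 -> [set y | comparable x y] y.
    have : \forall p \near (t, s), coord p.1 x != 0.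
      exact: (cvg_fst (G := nbhs s) (near_star tx)).
    by apply: filterS => p px y; apply: coord_chain.
  have starN (u : realization R Q) :
      (forall y, coord u y != 0 -> [set y | comparable x y] y) -> valid u N.
    by move=> H' y /H' uy; apply: vN.
  have near_eq : \forall p \near (t, s), fence' p.1 p.2 N.+1 z = coord (H p) z.
    by apply: filterS star => p /starN vp; rewrite (HP p N).
  have star0 y : coord t y != 0 -> [set y | comparable x y] y by apply: coord_chain.
  rewrite (HP (t, s) N) /=; last exact: starN.
  apply: cvg_trans (near_eq_cvg near_eq) _.
  apply: (fence_cvg (Qlf x) star star0).
  + move=> y; apply: (@cvg_comp _ _ _ fst (fun u => coord u y) _ (nbhs t)); last exact: coord_cvg.
    exact: cvg_fst.
  + by move=> p y; apply: coord_ge0.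
  + by move=> y; apply: coord_ge0.
  + move=> n; apply: cvgM; last exact: cvg_cst.
    apply: cvgB; first exact: cvg_cst.
    apply: cvgM; first exact: cvg_cst.
    exact: cvg_snd.
- move=> t; apply: realization_inj; have [N vN] := ex t.
  rewrite (HP (t, 0) N) //=; apply/funext => z.
  rewrite /fence' (fence_ge phi (alt_weight t)).
    by rewrite pushw_id // => x tx; apply: (vN x tx); apply: leqnSn.
  by move=> n _; rewrite /tau mulr0 subr0 mul1r ler1n.
- move=> t; apply: realization_inj; have [N vN] := ex t.
  rewrite (HP (t, 1) N) //= x0E; apply/funext => z; rewrite /fence'.
  elim: N.+1 => [|K IH]; first by rewrite fence0 cE.
  rewrite fenceS IH (prism_le0 (alt_weight t K)) ?subrr ?addr0 // /tau mulr1.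
  by rewrite mulr_le0_ge0 ?ler0n // subr_le0 ler1n.
Qed.

End Zigzag.
End Contraction.

(** * Removal of elements with contractible links *)

Section Retraction.
Local Open Scope ring_scope.
Variables (R : realType) (P Q : cell_poset) (iota : P -> Q).
Hypothesis Qpo : partial_order Q.
Hypothesis Qlf : loc_finite Q.
Hypothesis iota_inj : injective iota.
Hypothesis iota_le : forall x y, cell_le x y <-> cell_le (iota x) (iota y).

Let W (w : Q) : Prop := forall x, iota x <> w.

(** The elements missing from the image of [iota] are grouped by [lab], and a chain meets at most
    one group. On the link [L i] of a group, the zigzag from [x] up to [psi i x] and down to [c i]
    is a contraction to [c i]. In the applications [o] is the order of [P] or its reverse, so that
    zigzags of either shape are covered. *)
Variables (I : Type) (lab : Q -> I) (psi : I -> P -> P) (c : I -> P).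
Variable (o : P -> P -> Prop).
Hypothesis lab_eq : forall w w', W w -> W w' -> comparable w w' -> lab w = lab w'.
Hypothesis o_trans : forall x y z, o x y -> o y z -> o x z.
Hypothesis o_anti : forall x y, o x y -> o y x -> x = y.
Hypothesis o_comparable : forall x y, o x y -> comparable x y.
Hypothesis comparable_o : forall x y, comparable x y -> o x y \/ o y x.

Let L (i : I) (x : P) : Prop := exists w, [/\ W w, lab w = i & comparable w (iota x)].

Hypothesis psi_mono : forall i x y, L i x -> L i y -> o x y -> o (psi i x) (psi i y).
Hypothesis psi_ge : forall i x, L i x -> o x (psi i x) /\ o (c i) (psi i x).

Let P_refl (x : P) : cell_le x x. Proof. by apply/iota_le; case: Qpo. Qed.

Let o_refl x : o x x.
Proof. by have [] := comparable_o (or_introl (P_refl x) : comparable x x). Qed.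

Let Plf : loc_finite P.
Proof.
move=> x; apply: (@sub_finite_set _ _ (iota @^-1` [set y | comparable (iota x) y])).
  by move=> y /= [xy|yx]; [left|right]; apply/iota_le.
by apply: finite_preimage => // y z _ _; apply: iota_inj.
Qed.

Let rest (t : Q -> R) (x : P) : R := t (iota x).
Let mass (t : Q -> R) : R := fsum (rest t).
(** Normalizing by the mass on [P] breaks down when that mass tends to 0. Below one half the divisor
    therefore stays [1/2], and the second term of [E] puts the deficit at [c i]. *)
Let cap (t : Q -> R) : R := Num.max (mass t) 2^-1.
Let phi (i : I) (n : nat) (x : P) : P :=
  if n is m.+1 then (if m is _.+1 then c i else psi i x) else x.
(** A stage is over once its time reaches [mass t]. At mass 1 neither stage has begun. At mass [3/4]
    the first time equals the mass, and the second stage is just about to begin. At mass [1/2] and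
    below both stages are over, so everything is at [c i] before [cap] ceases to follow the mass. *)
Let time (t : Q -> R) (n : nat) : R := 3 * (1 - mass t) - (if n is 0%N then 0 else 3 / 4).

(* The part of [t] outside [W] is contracted in the link of the removed cells,
   the further the more mass they carry. *)
Let E (i : I) (t : Q -> R) (z : P) : R :=
  (cap t)^-1 * fence (alternate o) (phi i) (rest t) (time t) 2 z +
  (1 - (cap t)^-1 * mass t) * `[< c i = z >]%:R.

Let cap_gt0 t : 0 < cap t.
Proof. by rewrite /cap lt_max; apply/orP; right; rewrite invr_gt0 ltr0n. Qed.

Let rest_weight (t : realization R Q) :
  weight (@cell_le P) (mass (coord t)) (rest (coord t)).
Proof.
have [t1 t2 t3 _] := point_weight t; split=> //.
- apply: (@sub_finite_set _ _ (iota @^-1` [set y | coord t y != 0])) => //.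
  by apply: finite_preimage => // y z _ _; apply: iota_inj.
- by move=> x y tx ty; have [xy|yx] := t2 _ _ tx ty; [left|right]; apply/iota_le.
- by move=> x; apply: t3.
Qed.

Let rest_o_weight (t : realization R Q) n :
  weight (alternate o n) (mass (coord t)) (rest (coord t)).
Proof.
apply: (alternate_weight o n _ _).1; apply: weight_comparable (rest_weight t).
by move=> x y xy; apply: comparable_o; left.
Qed.

Let mass1 (t : realization R Q) : (forall w, W w -> coord t w = 0) -> mass (coord t) = 1.
Proof.
move=> tW; have [_ _ _ <-] := point_weight t.
have [r1 _ _ _] := rest_weight t; have [K uK KP] := finite_listP r1.
rewrite /mass (fsumE uK); last by move=> x /(KP x).2.
rewrite (@fsumE _ _ [seq iota x : {classic Q} | x <- K]).
- by rewrite big_map.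
- by rewrite (@map_inj_uniq {classic P} {classic Q} iota).
- move=> q tq; have [x xq] : exists x, iota x = q.
    by apply: contrapT => no; move: tq; rewrite tW ?eqxx // => x xq; apply: no; exists x.
  rewrite -xq; apply: (@map_f {classic P} {classic Q}); apply/KP.
  by rewrite /= /rest xq.
Qed.

Let Ew i (t : realization R Q) :
  (exists w, [/\ W w, coord t w != 0 & lab w = i]) ->
  weight (@cell_le P) 1 (E i (coord t)).
Proof.
move=> [w [Ww tw lw]].
have [t1 t2 t3 t4] := point_weight t.
have rL x : rest (coord t) x != 0 -> L i x.
  by move=> tx; exists w; split=> //; apply: t2.
have aw := rest_o_weight t.
set M := mass (coord t) in aw *.
have M_ge0 : 0 <= M by apply: fsumr_ge0 => x _; apply: t3.
have [M2|M2] := leP 2^-1 M.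
  have capE : cap (coord t) = M by rewrite /cap -/M max_l.
  have M0 : 0 < M by rewrite -capE.
  have [|n n2 fE] := fence_prism (phi i) aw (tau := time (coord t)) (N := 1).
    move=> n m nm; have [-> ->] : n = 0%N /\ m = 1%N by lia.
    by rewrite /time -/M /=; lra.
  have -> : E i (coord t) = fun z =>
      M^-1 * prism (alternate o n) (phi i n) (phi i n.+1) (rest (coord t)) (time (coord t) n) z.
    by apply/funext => z; rewrite /E capE -/M mulVf ?gt_eqF // subrr mul0r addr0 fE.
  apply: weight_scale => //.
  apply: (@weight_comparable _ _ (alternate o n)).
    by move=> x y; rewrite /alternate; case: odd => /o_comparable; rewrite /comparable; tauto.
  apply: (prism_weight (aw n) (alternate_trans o_trans (n := n))
    (alternate_anti o_anti (n := n)) _ (o' := alternate o n)).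
  - exact: alternate_trans.
  - move=> x y /rL Lx /rL Ly; case: n n2 {fE} => [|[|n]] //= _;
      by rewrite /alternate /=; split=> //; apply: psi_mono.
  - move=> x /rL Lx; have [ge1 ge2] := psi_ge Lx.
    by case: n n2 {fE} => [|[|n]] //= _; rewrite /alternate /=.
have capE : cap (coord t) = 2^-1 by rewrite /cap -/M max_r // ltW.
have -> : E i (coord t) = fun z => `[< c i = z >]%:R.
  apply/funext => z; rewrite /E capE invrK (fence_ge _ aw).
    rewrite (@pushw_cst _ _ _ _ _ (c i)) //; last by case: (aw 0%N).
    by rewrite -/(mass _) -/M; ring.
  by move=> [|[|n]] //= _; rewrite /time -/M /=; lra.
exact/weight_delta/P_refl.
Qed.

Let E_id i (t : realization R Q) : (forall w, W w -> coord t w = 0) ->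
  E i (coord t) = rest (coord t).
Proof.
move=> tW; have M1 := mass1 tW; have aw := rest_o_weight t.
have capE : cap (coord t) = 1 by rewrite /cap M1 max_l // invf_le1 ?ltr0n // ler1n.
apply/funext => z; rewrite /E capE M1 mulr1 invr1 subrr mul0r addr0 mul1r.
rewrite !fenceS fence0 !(prism_le0 (aw _)) ?subrr ?addr0 ?pushw_id //;
  by rewrite /time M1 subrr mulr0 sub0r oppr_le0 // divr_ge0.
Qed.

Let E_cvg i (t : realization R Q) z :
  E i (coord u) z @[u --> t] --> E i (coord t) z.
Proof.
have FF := nbhs_filter t.
have [q tq] := point_neq0 t.
pose A := iota @^-1` [set y | comparable q y].
have finA : finite_set A.
  by apply: finite_preimage => // y y' _ _; apply: iota_inj.
have nA : \forall u \near t, forall x, rest (coord u) x != 0 -> A x.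
  by apply: filterS (near_star tq) => u uq x; apply: coord_chain.
have tA x : rest (coord t) x != 0 -> A x by apply: coord_chain.
have cr x : rest (coord u) x @[u --> t] --> rest (coord t) x by apply: coord_cvg.
have cM : mass (coord u) @[u --> t] --> mass (coord t) by apply: (fsum_cvg finA).
have cC : (cap (coord u))^-1 @[u --> t] --> (cap (coord t))^-1.
  by apply: cvgV; [rewrite gt_eqF|apply: cvg_maxr => //; apply: cvg_cst].
apply: cvgD.
  apply: cvgM => //; apply: (fence_cvg finA nA tA) => //.
  - by move=> u x; apply: coord_ge0.
  - by move=> x; apply: coord_ge0.
  - move=> n; apply: cvgB; last exact: cvg_cst.
    by apply: cvgM; [apply: cvg_cst|apply: cvgB => //; apply: cvg_cst].
apply: cvgM; last exact: cvg_cst.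
by apply: cvgB; [apply: cvg_cst|apply: cvgM].
Qed.

(** The formulas [E i] combine to a map [r] that restricts to the identity on the copy [j] of the
    smaller realization; composing the given contraction with [j] and [r] contracts the retract. *)
Lemma retract_contractible :
  contractible_total R (realization R Q) -> contractible_total R (realization R P).
Proof.
have [Q_refl Q_trans Q_anti] := Qpo.
(* For a point without missing elements [E i] is independent of [i]. Insisting that [i] be the label
   of some element of the support keeps the number of labels occurring near a point finite. *)
have /choice[r rP] : forall t : realization R Q, exists t' : realization R P, exists i,
    [/\ forall w, W w -> coord t w != 0 -> lab w = i,
        exists2 q, coord t q != 0 & lab q = i & coord t' = E i (coord t)].
  move=> t; have [t1 t2 t3 t4] := point_weight t.
  have [[w [Ww tw]]|no] := pselect (exists w, W w /\ coord t w != 0).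
    have [|t' t'E] := @weight_point R P (E (lab w) (coord t)).
      by apply: Ew; exists w.
    exists t', (lab w); split=> //; last by exists w.
    by move=> w' Ww' tw'; apply: lab_eq => //; apply: t2.
  have tW w : W w -> coord t w = 0.
    by move=> Ww; apply/eqP; apply: contraT => tw; case: no; exists w.
  have [q tq] := point_neq0 t.
  have [|t' t'E] := @weight_point R P (rest (coord t)).
    by rewrite -(mass1 tW); apply: rest_weight.
  exists t', (lab q); split; [|by exists q|by rewrite E_id].
  by move=> w /tW ->; rewrite eqxx.
have r_cont : continuous r.
  move=> t; apply: (realization_cvg (nbhs_filter t)) => // z.
  have FF := nbhs_filter t.
  have [q tq] := point_neq0 t.
  have [i0 [tlab _ rE]] := rP t.
  (* The label may vary near [t], but only within the finite set [S], and for each label in it [E i]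
     has the same value at [t]. *)
  pose S := lab @` [set y | comparable q y] `&` [set i | E i (coord t) z = coord (r t) z].
  have finS : finite_set S by apply: finite_setIl; apply: finite_image; apply: Qlf.
  have nS : \forall u \near t, exists2 i, S i & coord (r u) z = E i (coord u) z.
    have [[w [Ww tw]]|no] := pselect (exists w, W w /\ coord t w != 0).
      apply: filterS2 (near_star tq) (near_star tw) => u uq uw.
      have [i [ulab [q' uq' q'i] ->]] := rP u; exists i => //; split.
        by exists q' => //; apply: (coord_chain (r := u)).
      by rewrite /= rE -(ulab w) // (tlab w).
    have tW w : W w -> coord t w = 0.
      by move=> Ww; apply/eqP; apply: contraT => tw; case: no; exists w.
    apply: filterS (near_star tq) => u uq.
    have [i [ulab [q' uq' q'i] ->]] := rP u; exists i => //; split.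
      by exists q' => //; apply: (coord_chain (r := u)).
    by rewrite /= rE !E_id.
  apply/cvgrPdist_lt => e e0.
  have nE : \forall u \near t, forall i, S i -> `|coord (r t) z - E i (coord u) z| < e.
    apply: (@near_finite _ (nbhs t) _ _ S
      (fun i u => `|coord (r t) z - E i (coord u) z| < e) finS).
    move=> i [_ /= <-].
    by move/cvgrPdist_lt : (E_cvg (i := i) (t := t) (z := z)); apply.
  by apply: filterS2 nS nE => u [i Si ->] /(_ i Si).
have /choice[j jP] : forall t : realization R P, exists t' : realization R Q,
    coord t' = pushw iota (coord t).
  move=> t; apply: weight_point.
  have tw := point_weight t.
  (* Written as a prism between equal maps, the pushforward is a point by [prism_weight]. *)
  have E0 : prism (@cell_le P) iota iota (coord t) 0 = pushw iota (coord t).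
    by apply: (@prism_same R P (@cell_le P)) => //; case: tw.
  rewrite -E0; apply: (prism_weight tw) => //.
  - by move=> x y z /iota_le xy /iota_le yz; apply/iota_le; apply: Q_trans yz.
  - by move=> x y /iota_le xy /iota_le yx; apply: iota_inj; apply: Q_anti.
  - by move=> x y _ _ /iota_le.
have j_cont : continuous j.
  move=> t; apply: (realization_cvg (nbhs_filter t)) => // q; rewrite jP.
  have FF := nbhs_filter t; have [x tx] := point_neq0 t.
  under eq_cvg do rewrite jP.
  apply: (pushw_cvg (Plf x)).
  - by apply: filterS (near_star tx) => u ux y; apply: coord_chain.
  - by move=> y; apply: coord_chain.
  - by move=> y; apply: coord_cvg.
have jE t x : coord (j t) (iota x) = coord t x.
  rewrite jP /pushw (@fsumE _ _ [:: x]) //; first by rewrite big_seq1 asboolT ?mul1r.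
  move=> y; rewrite inE; apply: contraR => /eqP yx.
  by rewrite asboolF ?mul0r // => /iota_inj.
have rj t : r (j t) = t.
  apply: realization_inj; have [i [_ _ ->]] := rP (j t).
  rewrite E_id; first by apply/funext => x; rewrite /rest jE.
  move=> w Ww; apply: contrapT => /eqP; rewrite jP => tw.
  have [x xw _] := pushw_neq0 tw; exact: Ww xw.
move=> [x0 [H [cH H0 H1]]].
exists (r x0), (fun p => r (H (j p.1, p.2))); split.
- move=> [t s]; apply: (@cvg_comp _ _ _ (fun p => H (j p.1, p.2)) r _ (nbhs (H (j t, s)))).
    apply: (@cvg_comp _ _ _ (fun p => (j p.1, p.2)) H _ (nbhs (j t, s))); last exact: cH.
    apply: (@cvg_pair _ _ _ (nbhs (t, s)) (nbhs (j t)) (nbhs s)); last exact: cvg_snd.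
    by apply: (@cvg_comp _ _ _ fst j _ (nbhs t)); [apply: cvg_fst|apply: j_cont].
  exact: r_cont.
- by move=> t; rewrite H0 rj.
- by move=> t; rewrite H1.
Qed.

End Retraction.

(** * Cells of the completion *)

Section Card.
Variable V : Type.
Implicit Types (A B : set V) (s : seq {classic V}).

Definition crd A : nat := #|` @fset_set {classic V} A|.

Lemma crd_list A s : uniq s -> (forall x : {classic V}, x \in s <-> A x) -> crd A = size s.
Proof.
move=> us sA; have -> : A = [set` s].
  by apply/seteqP; split=> x /sA.
have fin : finite_set [set` s] by apply: finite_seq.
apply: perm_size; apply: uniq_perm => //.
by move=> x; apply: (etrans (@in_fset_set {classic V} [set` s] fin x)); rewrite mem_setE.
Qed.

Lemma crd_sub A B : finite_set B -> A `<=` B -> crd A <= crd B.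
Proof.
move=> finB AB; have finA : finite_set A by apply: sub_finite_set finB.
have [s us sA] := finite_listP finA; have [t ut tB] := finite_listP finB.
rewrite (crd_list us sA) (crd_list ut tB); apply: uniq_leq_size => // x /sA/AB.
exact: (tB x).2.
Qed.

Lemma crd_eq A B : finite_set B -> A `<=` B -> crd B <= crd A -> A = B.
Proof.
move=> finB AB; have finA : finite_set A by apply: sub_finite_set finB.
have [s us sA] := finite_listP finA; have [t ut tB] := finite_listP finB.
rewrite (crd_list us sA) (crd_list ut tB) => le.
have st : {subset s <= t} by move=> x /sA/AB; apply: (tB x).2.
have [_ E] := uniq_min_size us st le.
by apply/seteqP; split=> // x /(tB x).2; rewrite -E => /sA.
Qed.

Lemma crd_range (J : finType) (v : J -> V) : injective v -> crd (range v) = #|J|.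
Proof.
move=> vi; rewrite (@crd_list _ [seq (v i : {classic V}) | i <- enum J]).
- by rewrite size_map -cardE.
- by rewrite (@map_inj_uniq _ {classic V}) ?enum_uniq.
- move=> x; split=> [/(@mapP J {classic V})[i _ ->]|[i _ <-]]; first by exists i.
  by apply: (@map_f J {classic V}); rewrite mem_enum.
Qed.

Definition subsingleton A : Prop := forall x y, A x -> A y -> x = y.

Lemma crdU A B : finite_set A -> finite_set B -> (forall x, A x -> ~ B x) ->
  crd (A `|` B) = crd A + crd B.
Proof.
move=> finA finB AB.
have [s us sA] := finite_listP finA; have [t ut tB] := finite_listP finB.
rewrite (crd_list us sA) (crd_list ut tB) -size_cat; apply: crd_list.
  rewrite cat_uniq us ut andbT; apply/hasPn => x /tB Bx; apply/negP => /sA Ax.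
  exact: AB Ax Bx.
move=> x; rewrite mem_cat; split=> [/orP[/sA|/tB]|[/sA|/tB] ->]; rewrite ?orbT //; by [left|right].
Qed.

Lemma crd_gt1 A : finite_set A -> ~ subsingleton A <-> 1 < crd A.
Proof.
move=> finA; have [s us sA] := finite_listP finA.
rewrite (crd_list us sA); split; last first.
  case: s us sA => [|a [|b s]] // us sA _ sub.
  have ab : a = b by apply: sub; apply/sA; rewrite !inE eqxx ?orbT.
  by move: us; rewrite /= ab inE eqxx.
apply: contra_notT; case: s us sA => [|a [|b s]] // us sA _ x y; first by move=> /sA.
by move=> /sA xa /sA ya; move: xa ya; rewrite !mem_seq1 => /eqP xa /eqP ya; rewrite xa ya.
Qed.

End Card.

Section Completion.
Variable G : graph.
Local Notation V := (vertex G).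
Variable col : V -> bool.
Hypothesis adj_col : forall u v, adj u v -> col u <> col v.
Hypothesis dart_unique : forall d d' : dart G, src d = src d' -> tgt d = tgt d' -> d = d'.
Implicit Types (T : set V) (u v w : V) (b : bool).

Definition color_class T b : set V := [set v | T v /\ col v = b].

Definition cross_adj T : Prop := forall u v, T u -> T v -> col u <> col v -> adj u v.

(* The vertex sets of the cells of the completion. *)
Definition cell_set T : Prop :=
  [/\ T !=set0, finite_set T, cross_adj T &
      subsingleton (color_class T true) <-> subsingleton (color_class T false)].

Lemma cell_setP T b : cell_set T ->
  subsingleton (color_class T b) <-> subsingleton (color_class T (~~ b)).
Proof. by case=> _ _ _; case: b => //=; tauto. Qed.

Lemma cell_set1 v : cell_set [set v].
Proof.
split; [by exists v|exact: finite_set1|by move=> x y -> ->|].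
by split=> _ x y [/= -> _] [/= -> _].
Qed.

Lemma cell_set2 u v : adj u v -> cell_set [set u; v].
Proof.
move=> uv; have ne := adj_col uv; split.
- by exists u; left.
- exact: finite_set2.
- by move=> x y [->|->] [->|->] // _; apply: adj_sym.
- have sub b : subsingleton (color_class [set u; v] b).
    by move=> x y [/= [->|->] <-] [/= [->|->] e] //; case: ne.
  by split=> _; apply: sub.
Qed.

Lemma cell_set2_adj u v : u <> v -> cell_set [set u; v] -> adj u v.
Proof.
move=> uv [_ _ adj sub]; apply: adj; [by left|by right|] => e.
move: sub.
have sub' : subsingleton (color_class [set u; v] (~~ col u)).
  by move=> x y [/= [->|->]]; rewrite ?e; case: col.
have nsub : ~ subsingleton (color_class [set u; v] (col u)).
  by move=> H; apply: uv; apply: H; split=> //=; by [left|right].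
by move: sub' nsub; case: (col u) => /=; tauto.
Qed.

Lemma crd_color_class T : finite_set T ->
  crd T = crd (color_class T true) + crd (color_class T false).
Proof.
move=> finT; rewrite -crdU.
- congr crd; apply/seteqP; split=> [x Tx|x [[]|[]] //].
  by case E : (col x); [left|right].
- by apply: sub_finite_set finT => x [].
- by apply: sub_finite_set finT => x [].
- by move=> x [_ e] [_]; rewrite e.
Qed.

(** If one colour class has two elements, then so has the other, and that makes four vertices. *)
Lemma cell_set_small T : cell_set T -> crd T <= 3 ->
  (exists v, T = [set v]) \/ (exists u v, adj u v /\ T = [set u; v]).
Proof.
move=> cT c3; have [[v Tv] finT adjT sub] := cT.
have fin b : finite_set (color_class T b) by apply: sub_finite_set finT => x [].
have {}sub b : subsingleton (color_class T b).
  apply: contrapT => nb.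
  have nb' : ~ subsingleton (color_class T (~~ b)) by move=> /(cell_setP b cT).
  have := (crd_gt1 (fin b)).1 nb; have := (crd_gt1 (fin (~~ b))).1 nb'.
  by move: c3; rewrite crd_color_class //; case: b {nb nb'} => /=; lia.
have [[u [Tu uv]]|no] := pselect (exists u, T u /\ col u <> col v).
  right; exists u, v; split; first exact: adjT.
  apply/seteqP; split=> [x Tx|x [->|->] //].
  have [xv|xv] := eqVneq (col x) (col v); [right|left].
    by apply: (sub (col v)).
  apply: (sub (col u)) => //; split=> //.
  by move: xv uv; case: (col x) (col u) (col v) => -[] [].
left; exists v; apply/seteqP; split=> [x Tx|x -> //].
apply: (sub (col v)); split=> //; apply: contrapT => xv.
by apply: no; exists x.
Qed.

Section Frame.
Variables (m n : nat) (v : 'I_m.+1 + 'I_n.+1 -> V).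
Hypothesis v_inj : injective v.
Hypothesis v_adj : forall i j, adj (v (inl i)) (v (inr j)).

Lemma frame_col i : col (v i) = if i is inl _ then col (v (inl ord0)) else ~~ col (v (inl ord0)).
Proof.
have H a j : col (v (inl a)) = ~~ col (v (inr j)).
  by have := adj_col (v_adj a j); case: (col _) (col _) => -[].
case: i => [a|j]; first by rewrite (H a ord0) (H ord0 ord0).
by rewrite (H ord0 j) negbK.
Qed.

Definition frame_set (U : {set 'I_m.+1 + 'I_n.+1}) : set V := v @` [set i | i \in U].

Lemma frame_setP U i : frame_set U (v i) <-> i \in U.
Proof. by split=> [[j jU /v_inj <-]|iU] //; exists i. Qed.

Lemma frame_set_sub U U' : frame_set U `<=` frame_set U' <-> U \subset U'.
Proof.
split=> [sub|/fintype.subsetP sub]; last by move=> _ [i /= /sub iU <-]; exists i.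
by apply/fintype.subsetP => i iU; apply/frame_setP/sub/frame_setP.
Qed.

Lemma frame_set_cell U : spanworthy U <-> cell_set (frame_set U).
Proof.
set b := col (v (inl ord0)).
have L : #|[set a | inl a \in U]%SET| <= 1 <-> subsingleton (color_class (frame_set U) b).
  split=> [le x y [[[i|i] iU <-] xb] [[[j|j] jU <-] yb]|sub].
  - congr (v (inl _)); apply: (fintype.card_le1_eqP le); by rewrite inE.
  - by move: yb; rewrite frame_col -/b; case: (b).
  - by move: xb; rewrite frame_col -/b; case: (b).
  - by move: yb; rewrite frame_col -/b; case: (b).
  apply/fintype.card_le1_eqP => i j; rewrite !inE => iU jU.
  have /v_inj[//] : v (inl i) = v (inl j).
  by apply: sub; split; rewrite ?frame_col //; apply/frame_setP.
have Rr : #|[set a | inr a \in U]%SET| <= 1 <-> subsingleton (color_class (frame_set U) (~~ b)).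
  split=> [le x y [[[i|i] iU <-] xb] [[[j|j] jU <-] yb]|sub].
  - by move: yb; rewrite frame_col -/b; case: (b).
  - by move: xb; rewrite frame_col -/b; case: (b).
  - by move: yb; rewrite frame_col -/b; case: (b).
  - congr (v (inr _)); apply: (fintype.card_le1_eqP le); by rewrite inE.
  apply/fintype.card_le1_eqP => i j; rewrite !inE => iU jU.
  have /v_inj[//] : v (inr i) = v (inr j).
  by apply: sub; split; rewrite ?frame_col //; apply/frame_setP.
split=> [/andP[/finset.set0Pn[i iU] /eqP E]|cU].
  split; first by exists (v i); apply/frame_setP.
  - by apply: finite_image; apply: finite_finset.
  - move=> _ _ [[x|x] _ <-] [[y|y] _ <-]; move=> ne.
    + by case: ne; rewrite (frame_col (inl x)) (frame_col (inl y)).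
    + exact: v_adj.
    + exact/adj_sym/v_adj.
    + by case: ne; rewrite (frame_col (inr x)) (frame_col (inr y)).
  - have {E} E : subsingleton (color_class (frame_set U) b) <->
        subsingleton (color_class (frame_set U) (~~ b)) by rewrite -L -Rr E.
    by move: E; case: (b) => /=; tauto.
have E := cell_setP b cU; apply/andP; split.
  by case: cU => -[_ [i iU _]] _ _ _; apply/finset.set0Pn; exists i.
by apply/eqP; apply/idP/idP => [/L/E/Rr|/Rr/E/L].
Qed.

End Frame.
End Completion.

Definition bisimplex_face m n (U : {set 'I_m.+1 + 'I_n.+1}) (spU : spanworthy U) :
  bisimplex m n := @exist _ (fun U => is_true (spanworthy U)) U spU.

(** * Skeleta as posets of vertex sets *)

Section Skeleton.
Variable G : graph.
Local Notation V := (vertex G).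
Variable col : V -> bool.
Hypothesis adj_col : forall u v, adj u v -> col u <> col v.
Hypothesis dart_unique : forall d d' : dart G, src d = src d' -> tgt d = tgt d' -> d = d'.
Implicit Types (T : set V) (u v w : V).
Local Notation cell_set := (@cell_set G col).

(** A bisimplex of dimension [k] has [k + 2] vertices, so the [k]-skeleton satisfies this with
    [N = k + 2]. For the graph itself [N] is 3, although no cell has exactly three vertices. *)
Record vertex_sets (P : cell_poset) (vs : P -> set V) (N : nat) : Prop := VertexSets {
  vs_cell : forall x, cell_set (vs x);
  vs_crd : forall x, crd (vs x) <= N;
  vs_surj : forall T, cell_set T -> crd T <= N -> exists x, vs x = T;
  vs_inj : injective vs;
  vs_le : forall x y, cell_le x y <-> vs x `<=` vs y
}.

Lemma crd1 v : crd [set v] = 1.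
Proof. by apply: (@crd_list _ _ [:: v]) => // x; rewrite mem_seq1; split=> [/eqP|->]. Qed.

Section Glue.
Variables (P : cell_poset) (vs : P -> set V) (k : nat).
Hypothesis vsP : vertex_sets vs k.+1.
Hypothesis k_gt1 : 1 < k.

Let vs1 w : exists x, vs x = [set w].
Proof. by apply: (vs_surj vsP); [apply: cell_set1|rewrite crd1]. Qed.

Let fin_vs x : finite_set (vs x). Proof. by have [] := vs_cell vsP x. Qed.

(** Singletons are the minimal faces, so [phi] sends them to single vertices, and [vs (phi U)] is
    the image of [U] under the resulting map [v]. The pairs of [inl i] and [inr j] are proper faces,
    so they become edges and [T] is complete bipartite. Conversely, a cell of [P] within [T] has
    fewer vertices than [T], so it comes from a proper face. Thus [T] determines [S]. *)
Lemma boundary_frame (S : set P) : is_bisimplex_boundary k S ->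
  let T := \bigcup_(x in S) vs x in
  [/\ cell_set T, crd T = k.+2 & S = [set x | vs x `<=` T]].
Proof.
move=> [subS [m [n [m0 n0 mn [phi [bij phi_le]]]]]] T.
have [phiS phi_inj phi_surj] := bij.
have span1 (i : 'I_m.+1 + 'I_n.+1) : spanworthy [set i]%SET.
  apply/andP; split; first by apply/finset.set0Pn; exists i; rewrite inE.
  have c1 (A : finType) (f : A -> 'I_m.+1 + 'I_n.+1) : injective f ->
      #|[set a | f a \in [set i]]%SET| <= 1.
    move=> f_inj; apply/fintype.card_le1_eqP => a a'; rewrite !inE => /eqP <- /eqP.
    by move=> /f_inj ->.
  rewrite !c1 //; [by move=> a a' []|by move=> a a' []].
pose sg i := bisimplex_face (span1 i).
have cardJ : #|{: 'I_m.+1 + 'I_n.+1}| = k.+2.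
  by rewrite card_sum !card_ord; lia.
have not_full (U : {set 'I_m.+1 + 'I_n.+1}) : #|U| <= 2 -> U != [set: _]%SET.
  move=> U2; apply: contraTneq U2 => ->; rewrite cardsT cardJ; lia.
have sgB i : bisimplex_boundary (sg i).
  by rewrite /bisimplex_boundary /=; apply: not_full; rewrite cards1.
have inh (U : bisimplex m n) : exists i, i \in val U.
  by have /andP[/finset.set0Pn[i iU] _] := valP U; exists i.
have point x w : S x -> vs x w -> exists U : bisimplex m n,
    [/\ bisimplex_boundary U, vs (phi U) = [set w] & cell_le (phi U) x].
  move=> Sx xw; have [y yw] := vs1 w.
  have yx : cell_le y x by apply/(vs_le vsP); rewrite yw => _ ->.
  have [U BU Uy] := phi_surj _ (subS _ _ yx Sx).
  by exists U; rewrite Uy.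
have /choice[v vE] : forall i, exists w, vs (phi (sg i)) = [set w].
  move=> i.
  have [[w iw] _ _ _] := vs_cell vsP (phi (sg i)).
  have [U [BU Uw Ui]] := point _ w (phiS _ (sgB i)) iw.
  exists w; rewrite -Uw; congr (vs (phi _)); apply: val_inj => /=.
  have /phi_le /= : cell_le (phi U) (phi (sg i)) by [].
  move=> /(_ BU (sgB i)) UI; have [j jU] := inh U.
  apply/eqP; rewrite finset.eqEsubset UI andbT finset.sub1set.
  by have := fintype.subsetP UI _ jU; rewrite inE => /eqP <-.
have v_inj : injective v.
  move=> i j vij; have /phi_inj : phi (sg i) = phi (sg j).
    by apply: (vs_inj vsP); rewrite !vE vij.
  rewrite !inE => /(_ (sgB i) (sgB j)) /(congr1 val) /= /finset.setP /(_ i).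
  by rewrite !inE eqxx => /esym/eqP.
have vsU (U : bisimplex m n) : bisimplex_boundary U -> vs (phi U) = frame_set v (val U).
  move=> BU; apply/seteqP; split=> [w Uw|_ [i iU <-]].
    have [U' [BU' U'w U'U]] := point _ w (phiS _ BU) Uw.
    have [i iU'] := inh U'; exists i.
      by apply: (fintype.subsetP ((phi_le _ _ BU' BU).1 U'U)).
    have : cell_le (phi (sg i)) (phi U') by apply/phi_le => //=; rewrite finset.sub1set.
    by move=> /(vs_le vsP); rewrite U'w vE; apply.
  have : cell_le (phi (sg i)) (phi U) by apply/phi_le => //=; rewrite finset.sub1set.
  by move=> /(vs_le vsP); rewrite vE; apply.
have TE : T = range v.
  apply/seteqP; split=> [w [x Sx xw]|_ [i _ <-]]; last first.
    by exists (phi (sg i)); [apply: phiS|rewrite vE].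
  have [U BU Ux] := phi_surj _ Sx.
  by move: xw; rewrite -Ux vsU // => -[i _ <-]; exists i.
have v_adj i j : adj (v (inl i)) (v (inr j)).
  have span2 : spanworthy [set inl i; inr j]%SET.
    apply/andP; split; first by apply/finset.set0Pn; exists (inl i); rewrite !inE eqxx.
    have E1 : #|[set a : 'I_m.+1 | inl a \in [set (inl i : 'I_m.+1 + 'I_n.+1); inr j]]%SET| <= 1.
      by apply/fintype.card_le1_eqP => a a'; rewrite !inE /= !orbF => /eqP[->] /eqP[->].
    have E2 : #|[set a : 'I_n.+1 | inr a \in [set (inl i : 'I_m.+1 + 'I_n.+1); inr j]]%SET| <= 1.
      by apply/fintype.card_le1_eqP => a a'; rewrite !inE /= => /eqP[->] /eqP[->].
    by rewrite E1 E2.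
  pose U := bisimplex_face span2.
  have BU : bisimplex_boundary U.
    by rewrite /bisimplex_boundary /=; apply: not_full; rewrite cards2; case: eqP.
  have UE : vs (phi U) = [set v (inl i); v (inr j)].
    rewrite vsU //; apply/seteqP; split=> [_ [x + <-]|_ [->|->]].
    - by rewrite /= !inE => /orP[/eqP->|/eqP->]; [left|right].
    - by apply/frame_setP => //; rewrite !inE eqxx.
    - by apply/frame_setP => //; rewrite !inE eqxx orbT.
  apply: (@cell_set2_adj _ col); first by move=> /v_inj.
  by rewrite -UE; apply: vs_cell vsP _.
have frameT : frame_set v [set: _]%SET = T.
  rewrite TE; apply/seteqP; split=> [_ [i _ <-]|_ [i _ <-]]; first by exists i.
  by apply/(frame_setP v_inj); rewrite finset.in_setT.
have crdT : crd T = k.+2 by rewrite TE crd_range.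
have finT : finite_set T by rewrite TE; apply: finite_image; apply: finite_finset.
split=> //.
  rewrite -frameT; apply/(frame_set_cell adj_col v_inj v_adj).
  apply/andP; split; first by apply/finset.set0Pn; exists (inl ord0); rewrite inE.
  have C l (f : 'I_l.+1 -> 'I_m.+1 + 'I_n.+1) : 0 < l ->
      (#|[set a | f a \in [set: 'I_m.+1 + 'I_n.+1]]%SET| <= 1) = false.
    move=> l0; rewrite (_ : [set a | _]%SET = [set: 'I_l.+1]%SET).
      by rewrite cardsT card_ord; lia.
    by apply/finset.setP => a; rewrite !inE.
  by rewrite !C.
apply/seteqP; split=> [x Sx w xw|x /= xT]; first by exists x.
pose U := [set i | `[< vs x (v i) >]]%SET.
have xE : vs x = frame_set v U.
  apply/seteqP; split=> [w xw|_ [i + <-]]; last by rewrite /= inE => /asboolP.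
  have := xT _ xw; rewrite TE => -[i _ iw]; exists i => //=.
  by rewrite inE iw; apply/asboolP.
have spU : spanworthy U.
  by apply/(frame_set_cell adj_col v_inj v_adj); rewrite -xE; apply: vs_cell vsP _.
have BU : bisimplex_boundary (bisimplex_face spU).
  rewrite /bisimplex_boundary /=; apply/eqP => UT.
  by have := vs_crd vsP x; rewrite xE UT frameT crdT ltnn.
suff <- : phi (bisimplex_face spU) = x by apply: phiS.
by apply: (vs_inj vsP); rewrite vsU //= xE.
Qed.

Lemma frame_exists T : cell_set T -> 3 < crd T -> exists m n (v : 'I_m.+1 + 'I_n.+1 -> V),
  [/\ 0 < m, 0 < n, injective v, forall i j, adj (v (inl i)) (v (inr j)) & range v = T].
Proof.
move=> cT T3; have [[v0 _] finT adjT _] := cT.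
have fin b : finite_set (color_class col T b) by apply: sub_finite_set finT => x [].
have big b : 1 < crd (color_class col T b).
  apply/crd_gt1 => // sub; have sub' := (cell_setP b cT).1 sub.
  have nb c : subsingleton (color_class col T c) -> crd (color_class col T c) <= 1.
    by move=> s; rewrite leqNgt; apply/negP => /(crd_gt1 (fin c)); apply.
  have := nb _ sub; have := nb _ sub'; move: T3; rewrite (crd_color_class col finT).
  by case: b {sub sub'} => /=; lia.
have [s us sP] := finite_listP (fin true); have [t ut tP] := finite_listP (fin false).
have s2 : 1 < size s by rewrite -(crd_list us sP).
have t2 : 1 < size t by rewrite -(crd_list ut tP).
pose m := (size s).-1; pose n := (size t).-1.
have sm : size s = m.+1 by rewrite /m; lia.
have tn : size t = n.+1 by rewrite /n; lia.
pose v (i : 'I_m.+1 + 'I_n.+1) : V :=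
  match i with inl i => nth (v0 : {classic V}) s i | inr j => nth (v0 : {classic V}) t j end.
have vs_ (i : 'I_m.+1) : v (inl i) \in s by apply: mem_nth; rewrite sm.
have vt_ (j : 'I_n.+1) : v (inr j) \in t by apply: mem_nth; rewrite tn.
exists m, n, v; split.
- by rewrite /m; lia.
- by rewrite /n; lia.
- move=> [i|i] [j|j] /= e.
  + congr inl; apply: val_inj; apply/eqP.
    by rewrite -(@nth_uniq {classic V} v0 s i j) ?sm //; apply/eqP.
  + have [_ /= c1] := (sP _).1 (vs_ i); have [_ /= c2] := (tP _).1 (vt_ j).
    by move: c1; rewrite e c2.
  + have [_ /= c1] := (sP _).1 (vs_ j); have [_ /= c2] := (tP _).1 (vt_ i).
    by move: c1; rewrite -e c2.
  + congr inr; apply: val_inj; apply/eqP.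
    by rewrite -(@nth_uniq {classic V} v0 t i j) ?tn //; apply/eqP.
- move=> i j; have [Ti ci] := (sP _).1 (vs_ i); have [Tj cj] := (tP _).1 (vt_ j).
  by apply: adjT => //; rewrite ci cj.
- apply/seteqP; split=> [_ [[i|j] _ <-]|w Tw].
  + by have [] := (sP _).1 (vs_ i).
  + by have [] := (tP _).1 (vt_ j).
  case E : (col w).
    have ws : (w : {classic V}) \in s by apply/sP.
    have lt : index (w : {classic V}) s < m.+1 by rewrite -sm index_mem.
    by exists (inl (Ordinal lt)) => //=; rewrite nth_index.
  have wt : (w : {classic V}) \in t by apply/tP.
  have lt : index (w : {classic V}) t < n.+1 by rewrite -tn index_mem.
  by exists (inr (Ordinal lt)) => //=; rewrite nth_index.
Qed.

Lemma frame_boundary T : cell_set T -> crd T = k.+2 ->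
  is_bisimplex_boundary k [set x | vs x `<=` T].
Proof.
move=> cT kT; split; first by move=> x y /(vs_le vsP) xy /= yT; apply: subset_trans yT.
have [|m [n [v [m0 n0 v_inj v_adj vT]]]] := frame_exists cT; first by rewrite kT; lia.
have finT : finite_set T by case: cT.
have mn : m + n = k.
  by have := crd_range v_inj; rewrite vT kT card_sum !card_ord; lia.
exists m, n; split=> //.
have frameT : frame_set v [set: _]%SET = T.
  rewrite -vT; apply/seteqP; split=> [_ [i _ <-]|_ [i _ <-]]; first by exists i.
  by apply/(frame_setP v_inj); rewrite finset.in_setT.
have sub U : frame_set v U `<=` T by rewrite -vT => _ [i _ <-]; exists i.
have small U : U != [set: _]%SET -> crd (frame_set v U) <= k.+1.
  move=> nU; rewrite leqNgt; apply/negP => gt; case/eqP: nU.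
  apply/eqP; rewrite finset.eqEsubset finset.subsetT /=.
  by apply/(frame_set_sub v_inj); rewrite frameT -(crd_eq finT (sub U)) // kT.
have [x0 _] := vs1 (v (inl ord0)).
have /choice[phi phiP] : forall U : bisimplex m n, exists x,
    bisimplex_boundary U -> vs x = frame_set v (val U).
  move=> U.
  have [BU|nBU] := pselect (bisimplex_boundary U); last by exists x0.
  have [|x xE] := @vs_surj _ _ _ vsP (frame_set v (val U)) _ (small _ BU).
    by apply/(frame_set_cell adj_col v_inj v_adj); apply: (valP U).
  by exists x.
exists phi; split; last first.
  move=> U U' BU BU'; rewrite (vs_le vsP) !phiP //.
  exact: frame_set_sub.
split.
- by move=> U BU /=; rewrite phiP.
- move=> U U'; rewrite !inE => BU BU' UU'; apply: val_inj.
  by apply/eqP; rewrite finset.eqEsubset; apply/andP; split;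
    apply/(frame_set_sub v_inj); rewrite -!phiP // UU'.
- move=> x /= xT; pose U := [set i | `[< vs x (v i) >]]%SET.
  have xE : vs x = frame_set v U.
    apply/seteqP; split=> [w xw|_ [i + <-]]; last by rewrite /= inE => /asboolP.
    have := xT _ xw; rewrite -vT => -[i _ iw]; exists i => //=.
    by rewrite inE iw; apply/asboolP.
  have spU : spanworthy U.
    by apply/(frame_set_cell adj_col v_inj v_adj); rewrite -xE; apply: vs_cell vsP _.
  have BU : bisimplex_boundary (bisimplex_face spU).
    rewrite /bisimplex_boundary /=; apply/eqP => UT.
    by have := vs_crd vsP x; rewrite xE UT frameT kT ltnn.
  by exists (bisimplex_face spU) => //; apply: (vs_inj vsP); rewrite phiP //= xE.
Qed.

Definition glue_vs (x : glue P k) : set V :=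
  match x with inl a => vs a | inr c => \bigcup_(y in sval c) vs y end.

Lemma glue_vertex_sets : vertex_sets glue_vs k.+2.
Proof.
have cP (c : {S : set P | is_bisimplex_boundary k S}) := boundary_frame (svalP c).
split.
- by move=> [a|c]; [apply: vs_cell vsP _|have [] := cP c].
- by move=> [a|c]; [apply: leqW; apply: vs_crd vsP _|have [_ /= -> _] := cP c].
- move=> T cT; rewrite leq_eqVlt => /predU1P[kT|lt].
    exists (inr (exist _ _ (frame_boundary cT kT))) => /=.
    apply/seteqP; split=> [w [x + /=]|w Tw]; first by apply.
    by have [x xE] := vs1 w; exists x; rewrite /= xE // => _ ->.
  by have [x xE] := vs_surj vsP cT lt; exists (inl x).
- have ne a c : glue_vs (inl a) <> glue_vs (inr c).
    move=> /= e; have := vs_crd vsP a; rewrite e.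
    by have [_ -> _] := cP c; rewrite ltnn.
  move=> [a|c] [b|d] /= e.
  + by congr inl; apply: vs_inj vsP _ _ e.
  + by case: (ne a d).
  + by case: (ne b c).
  + congr inr; have [_ _ cE] := cP c; have [_ _ dE] := cP d.
    have : sval c = sval d by rewrite cE dE e.
    by move: c d {e cE dE} => [S hS] [S' hS'] /= e; subst S'; congr exist; exact: Prop_irrelevance.
- move=> [a|c] [b|d] /=.
  + exact: (vs_le vsP).
  + by have [_ _ dE] := cP d; rewrite {1}dE.
  + split=> // sub; have [_ k1 _] := cP c.
    by have := crd_sub (fin_vs b) sub; rewrite k1 leqNgt ltnS (vs_crd vsP).
  + split=> [->|sub] //; have [_ kc cE] := cP c; have [[_ finD _ _] kd dE] := cP d.
    have e := crd_eq finD sub; have {}e := e _; rewrite kc kd leqnn in e; have {}e := e isT.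
    have : sval c = sval d by rewrite cE dE e.
    by move: c d {e cE dE sub kc kd finD} => [S hS] [S' hS'] /= e; subst S'; congr exist; exact: Prop_irrelevance.
Qed.

End Glue.
End Skeleton.

(** * The completion as the poset of all cell sets *)

Section CompletionCells.
Variable G : graph.
Local Notation V := (vertex G).
Variable col : V -> bool.
Hypothesis adj_col : forall u v, adj u v -> col u <> col v.
Hypothesis dart_unique : forall d d' : dart G, src d = src d' -> tgt d = tgt d' -> d = d'.
Local Notation cell_set := (@cell_set G col).

Definition graph_vs (x : graph_cells G) : set V :=
  match x with inl v => [set v] | inr e => [set v | incident v e] end.

Lemma edge_vs (e : edge G) :
  exists2 d, sval e = [set d; rev d] & graph_vs (inr e) = [set src d; tgt d].
Proof.
have [d ed] := svalP e; exists d => //; apply/seteqP; split=> [v [d' + <-]|v].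
  by rewrite ed => -[->|->]; [left|right].
by move=> [->|->]; [exists d|exists (rev d)] => //; rewrite ed; [left|right].
Qed.

Lemma dart_ne (d : dart G) : src d <> tgt d.
Proof. by move=> e; apply: (adj_col (u := src d) (v := tgt d)); [exists d|rewrite e]. Qed.

Lemma edge_sub (e f : edge G) : graph_vs (inr e) `<=` graph_vs (inr f) -> e = f.
Proof.
have [d ed ->] := edge_vs e; have [d' fd ->] := edge_vs f => sub.
have E : sval e = sval f.
  have s := sub _ (or_introl erefl : [set src d; tgt d] (src d)).
  have t := sub _ (or_intror erefl : [set src d; tgt d] (tgt d)).
  have ne := @dart_ne d; rewrite ed fd; case: s t => /= s [] /= t.
  - by case: ne; rewrite s t.
  - by rewrite (dart_unique s t).
  - have -> : d = rev d' by apply: dart_unique; rewrite ?tgt_rev.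
    by rewrite revK setUC.
  - by case: ne; rewrite s t.
by move: e f E {sub ed fd} => [e he] [f hf] /= E; subst f; congr exist; exact: Prop_irrelevance.
Qed.

Lemma graph_vertex_sets : vertex_sets col graph_vs 3.
Proof.
have edge_crd e : 1 < crd (graph_vs (inr e)) <= 3.
  have [d _ ->] := edge_vs e; rewrite (@crd_list _ _ [:: src d; tgt d]) //.
    by rewrite /= inE andbT; apply/eqP; apply: dart_ne.
  move=> x; rewrite !inE; split=> [/orP[/eqP->|/eqP->]|[->|->]]; rewrite ?eqxx ?orbT //; by [left|right].
split.
- move=> [v|e]; first exact: cell_set1.
  by have [d _ ->] := edge_vs e; apply: cell_set2 => //; exists d.
- move=> [v|e]; first by rewrite /= crd1.
  by have /andP[] := edge_crd e.
- move=> T cT c3; have [[v ->]|[u [v [[d <- <-] ->]]]] := cell_set_small cT c3.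
    by exists (inl v).
  pose e : edge G := exist _ [set d; rev d] (ex_intro _ d erefl).
  exists (inr e); apply/seteqP; split=> [w [d' [->|->] <-]|w [->|->]].
  + by left.
  + by right.
  + by exists d => //; left.
  + by exists (rev d) => //; right.
- move=> [v|e] [w|f].
  + by move=> /= vw; congr inl; have : [set v] v by []; rewrite vw.
  + by move=> E; have /andP[] := edge_crd f; rewrite -E /= crd1.
  + by move=> E; have /andP[] := edge_crd e; rewrite E /= crd1.
  + by move=> E; congr inr; apply: edge_sub; rewrite E.
- move=> [v|e] [w|f].
  + by split=> [/= ->|/(_ v erefl)].
  + by split=> [inc _ ->|/(_ v erefl)].
  + split=> // sub; have /andP[+ _] := edge_crd e.
    have := crd_sub _ sub; rewrite /= crd1 => /(_ (finite_set1 w)); lia.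
  + by split=> [/= ->|/edge_sub].
Qed.

Fixpoint skeleton_vs n : skeleton G n -> set V :=
  match n return skeleton G n -> set V with
  | 0 => graph_vs
  | n'.+1 => glue_vs (@skeleton_vs n') (k := n'.+2)
  end.

Lemma skeleton_vertex_sets n : vertex_sets col (@skeleton_vs n) n.+3.
Proof.
elim: n => [|n IH]; first exact: graph_vertex_sets.
exact: (glue_vertex_sets adj_col (k := n.+2) IH).
Qed.

Definition total_vs (x : {n & skeleton G n}) : set V := @skeleton_vs (projT1 x) (projT2 x).

Lemma total_inj x y : projT1 x = projT1 y -> total_vs x = total_vs y -> x = y.
Proof.
move: x y => [n a] [m b] /= nm; subst m => ab; congr existT.
exact: (vs_inj (skeleton_vertex_sets n)).
Qed.

Lemma iter_push i x : projT1 (iter i (@push G) x) = i + projT1 x /\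
  total_vs (iter i (@push G) x) = total_vs x.
Proof. by elim: i => // i [IH1 IH2]; split=> //=; rewrite IH1. Qed.

Definition completion_vs (c : completion G) : set V := total_vs (sval c).

Lemma completion_cell c : cell_set (completion_vs c).
Proof. exact: vs_cell (skeleton_vertex_sets _) _. Qed.

Lemma completion_surj T : cell_set T -> exists c, completion_vs c = T.
Proof.
move=> cT; have ex : exists n, `[< exists x, @skeleton_vs n x = T >].
  exists (crd T); apply/asboolP; apply: (vs_surj (skeleton_vertex_sets _) cT).
  by rewrite -addn3 leq_addr.
(* In the first skeleton where [T] occurs, its cell is not a pushed one. *)
case: (ex_minnP ex) => n /asboolP[x xT] nmin.
have nopush y : existT (fun n => skeleton G n : Type) n x <> push y.
  move=> E; have /= n1 := congr1 (@projT1 _ _) E.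
  have yT : total_vs y = T by rewrite -xT -[RHS]/(total_vs (existT _ n x)) E.
  have := nmin (projT1 y); rewrite n1 => H.
  suff : (projT1 y).+1 <= projT1 y by rewrite ltnn.
  by apply: H; apply/asboolP; exists (projT2 y).
by exists (exist _ _ nopush).
Qed.

(** Of two cells with the same vertices, the one from the lower skeleton can be pushed up until it
    equals the other. The latter is not a pushed cell, so the number of pushes is 0. *)
Lemma completion_inj : injective completion_vs.
Proof.
move=> c c' e.
wlog le : c c' e / projT1 (sval c) <= projT1 (sval c').
  by move=> W; have [le|/ltnW le] := leqP (projT1 (sval c)) (projT1 (sval c'));
    [apply: W|apply/esym/W].
have E : iter (projT1 (sval c') - projT1 (sval c)) (@push G) (sval c) = sval c'.
  have [E1 E2] := iter_push (projT1 (sval c') - projT1 (sval c)) (sval c).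
  by apply: total_inj; rewrite ?E1 ?E2 // subnK.
have {}E : sval c = sval c'.
  by move: E (svalP c'); case: (_ - _) => [|i] //= <- /(_ (iter i (@push G) (sval c))).
by move: c c' E {e le} => [x hx] [y hy] /= E; subst y; congr exist; exact: Prop_irrelevance.
Qed.

Lemma completion_le (c c' : completion G) :
  cell_le c c' <-> completion_vs c `<=` completion_vs c'.
Proof.
have vsE i x n a : iter i (@push G) x = existT _ n a -> total_vs x = @skeleton_vs n a.
  by move=> E; have [_ <-] := iter_push i x; rewrite E.
split=> [[i [j [n [a [b [ia jb ab]]]]]]|sub].
  by rewrite /completion_vs (vsE _ _ _ _ ia) (vsE _ _ _ _ jb); apply/(vs_le (skeleton_vertex_sets n)).
pose N := maxn (projT1 (sval c)) (projT1 (sval c')).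
have lift x : projT1 x <= N -> exists a, iter (N - projT1 x) (@push G) x = existT _ N a.
  move=> le; have [E1 _] := iter_push (N - projT1 x) x.
  rewrite subnK // in E1; move: E1; case: (iter _ _ _) => n a /= nN; subst n.
  by exists a.
have [a aE] := lift _ (leq_maxl _ _ : projT1 (sval c) <= N).
have [b bE] := lift _ (leq_maxr _ _ : projT1 (sval c') <= N).
exists (N - projT1 (sval c)), (N - projT1 (sval c')), N, a, b; split=> //.
by apply/(vs_le (skeleton_vertex_sets N)); rewrite -(vsE _ _ _ _ aE) -(vsE _ _ _ _ bE).
Qed.

End CompletionCells.

(** * Folding spheres *)

Definition family (V : Type) (F : set V -> Prop) : cell_poset :=
  @CellPoset {T : set V | F T} (fun S T => sval S `<=` sval T).

Section Family.
Variable V : Type.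
Implicit Types (F : set V -> Prop).

Definition member F T (FT : F T) : family F := @exist _ F T FT.

Lemma family_inj F (S T : family F) : sval S = sval T -> S = T.
Proof.
by move: S T => [S hS] [T hT] /= ST; subst T; congr exist; exact: Prop_irrelevance.
Qed.

Lemma family_order F : partial_order (family F).
Proof.
split=> [S|S T U|S T] //=; first exact: subset_trans.
by move=> ST TS; apply/family_inj/seteqP.
Qed.

Lemma family_loc_finite F (N : V -> set V) :
    (forall v, finite_set (N v)) ->
    (forall T, F T -> [/\ T !=set0, finite_set T & forall v, T v -> T `<=` N v]) ->
  loc_finite (family F).
Proof.
move=> finN HF S; have [[v Sv] finS _] := HF _ (svalP S).
have fin : finite_set [set B | B `<=` N v `|` sval S].
  by apply: finite_subsets; rewrite finite_setU.
apply: (@sub_finite_set _ _ ((sval : family F -> set V) @^-1` [set B | B `<=` N v `|` sval S])).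
  move=> T [ST|TS] w Tw /=; last by right; apply: TS.
  by left; have [_ _] := HF _ (svalP T); apply; [apply: ST Sv|].
by apply: finite_preimage => // A B _ _; apply: family_inj.
Qed.

Definition widen F F' (FF' : forall T, F T -> F' T) (S : family F) : family F' :=
  member (FF' _ (svalP S)).

(** The default [S] makes a total map out of an operation on sets that is known to stay in [F] only
    on a link. *)
Definition member_or F (S : family F) (T : set V) : family F :=
  if pselect (F T) is left FT then member FT else S.

Lemma member_orE F (S : family F) T : F T -> sval (member_or S T) = T.
Proof. by rewrite /member_or; case: pselect. Qed.

End Family.

Section Retractions.
Variable G : graph.
Local Notation V := (vertex G).
Hypothesis conn : connected_graph G.
Hypothesis iso4 : forall n (c : 'I_n -> dart G), isometric_cycle c -> n = 4.
Hypothesis finite_darts : forall v : V, finite_set [set d : dart G | src d = v].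
Variable x0 : V.
Implicit Types (u v w : V) (T : set V) (n m : nat).

Definition level v : nat := gdist conn x0 v.
Definition color v : bool := odd (level v).

Lemma level_adj u v : adj u v -> level u = (level v).+1 \/ level v = (level u).+1.
Proof. exact: gdist_adj_cases. Qed.

Lemma adj_color u v : adj u v -> color u <> color v.
Proof. by rewrite /color => /level_adj[->|->] /=; case: odd. Qed.

Lemma finite_neighbours v : finite_set [set u | adj v u].
Proof.
apply: sub_finite_set (finite_image (@tgt G) (finite_darts v)).
by move=> u [d dv du]; exists d.
Qed.

(** The lower neighbours of [v] are finite in number, so [common_lower_neighbour] treats them all at
    once. Vertices of level 1 go to the adjacent vertex [x0], which changes their colour and makes
    the last fold exceptional. *)
Lemma fold_exists v : exists u, (level v < 2 -> u = x0) /\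
  (1 < level v -> level u = (level v).-2 /\
     forall d, adj v d -> level d = (level v).-1 -> adj u d).
Proof.
have [lt|le] := ltnP (level v) 2; first by exists x0.
have lv : level v = (level v).-2.+2 by lia.
have [s us sP] := finite_listP (finite_neighbours v).
have [|u lu ud] := @common_lower_neighbour _ conn iso4 x0 v (level v).-2
    [seq d <- s | level d == (level v).-1] lv.
  by move=> d; rewrite mem_filter => /andP[/eqP ld /sP vd]; split=> //; rewrite -/(level d); lia.
exists u; split=> [lt|_]; first by lia.
split=> // d vd ld; apply: ud; rewrite mem_filter ld eqxx /=; exact/sP.
Qed.

Definition fold v : V := sval (cid (fold_exists v)).

Lemma fold_low v : level v < 2 -> fold v = x0.
Proof. by rewrite /fold; case: cid => u []. Qed.

Lemma level_fold v : 1 < level v -> level (fold v) = (level v).-2.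
Proof. by rewrite /fold; case: cid => u /= [_ H] /H[]. Qed.

Lemma fold_adj v d : 1 < level v -> adj v d -> level d = (level v).-1 -> adj (fold v) d.
Proof. by rewrite /fold; case: cid => u /= [_ H] /H[_]; apply. Qed.

Lemma color_fold v : 1 < level v -> color (fold v) = color v.
Proof. by move=> v1; rewrite /color level_fold //; case: (level v) v1 => [|[|n]] //= _; rewrite negbK. Qed.

Lemma lower_neighbour v : 0 < level v -> exists2 d, adj v d & level d = (level v).-1.
Proof.
move=> v0; have [|d vd dx] := @gdist_step _ conn (level v).-1 v x0.
  by rewrite gdistC prednK.
by exists d; rewrite // /level gdistC.
Qed.

Lemma level0 v : level v = 0 -> v = x0.
Proof. by move=> /gdist_eq0. Qed.

Lemma level_x0 : level x0 = 0.
Proof. exact: gdistxx. Qed.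

Definition biclique T : Prop :=
  [/\ finite_set T, cross_adj color T & exists u v, [/\ T u, T v & color u <> color v]].

Definition fold_pair T : Prop := exists2 v, 1 < level v & T = [set v; fold v].

Definition extended T : Prop := [\/ exists v, T = [set v], fold_pair T | biclique T].

(** Two vertices of an extended set are equal, adjacent or have a common neighbour. So the extended
    sets through [v] lie in this finite ball, which gives local finiteness of all the posets
    below. *)
Definition near2 v : set V :=
  [set v] `|` [set u | adj v u] `|` \bigcup_(u in [set u | adj v u]) [set w | adj u w].

Lemma finite_near2 v : finite_set (near2 v).
Proof.
rewrite /near2 !finite_setU; split; first split.
- exact: finite_set1.
- exact: finite_neighbours.
- by apply: bigcup_finite => [|u _]; apply: finite_neighbours.
Qed.

Lemma extended_local T : extended T ->
  [/\ T !=set0, finite_set T & forall v, T v -> T `<=` near2 v].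
Proof.
case=> [[v ->]|[v v1 ->]|[finT cross [a [b [Ta Tb ab]]]]].
- split; [by exists v|exact: finite_set1|by move=> w -> u ->; left; left].
- have [d vd ld] := lower_neighbour (ltnW v1); have fd := fold_adj v1 vd ld.
  split; [by exists v; left|exact: finite_set2|].
  by move=> u [->|->] w [->|->]; (try by left; left); right; exists d => //=; apply: adj_sym.
- split=> //; first by exists a.
  move=> v Tv w Tw; have [cvw|cvw] := pselect (color v = color w); last first.
    by left; right; apply: cross.
  have [u Tu vu] : exists2 u, T u & color v <> color u.
    by have [va|va] := pselect (color v = color a); [exists b; rewrite // va|exists a].
  by right; exists u; apply: cross => //; rewrite -cvw => e; apply: vu.
Qed.

Definition fold_at m v : V := if level v == m then fold v else v.

Lemma fold_at_level m v : 0 < m -> level v <= m -> level (fold_at m v) < m.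
Proof.
move=> m0 vm; rewrite /fold_at; case: eqP => [vm'|]; last by lia.
have [lt|le] := ltnP (level v) 2; first by rewrite fold_low // level_x0.
by rewrite level_fold //; lia.
Qed.

(** A vertex [u] of level [m] in a biclique [T] has its neighbours in [T] at level [m - 1], and
    [fold u] is adjacent to all of these. For [m > 1] folding preserves colours, so replacing [u] by
    [fold u], or adding it, keeps the two colours completely joined. A single vertex and its fold
    form a pair. *)
Lemma fold_at_extended m T : 0 < m -> extended T -> (forall v, T v -> level v <= m) ->
  extended (fold_at m @` T) /\ extended (T `|` fold_at m @` T).
Proof.
move=> m0 ET Tm; set g := fold_at m.
have g_id v : level v <> m -> g v = v by rewrite /g /fold_at; case: eqP.
have g_fold v : level v = m -> g v = fold v by rewrite /g /fold_at => ->; rewrite eqxx.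
case: ET Tm => [[v ->]|[v v1 ->]|[finT cross [a [b [Ta Tb ab]]]]] Tm.
- rewrite image_set1; split; first by apply: Or31; exists (g v).
  have [vm|vm] := eqVneq (level v) m; last first.
    by rewrite g_id ?setUid; [apply: Or31; exists v|exact/eqP].
  rewrite g_fold //; have [le|gt] := leqP m 1; last by apply: Or32; exists v; rewrite ?vm.
  have lv : level v = 1 by lia.
  rewrite fold_low ?lv //; have xv : adj x0 v by apply: (@adj_gdist _ conn).
  apply: Or33; split; first exact: finite_set2.
  + by move=> u w [->|->] [->|->] // _; apply: adj_sym.
  + by exists v, x0; split; [left|right|apply/adj_color/adj_sym].
- have fv : g (fold v) = fold v.
    by apply: g_id; rewrite level_fold //; have := Tm v (or_introl erefl); lia.
  have [vm|vm] := eqVneq (level v) m.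
    have E : g @` [set v; fold v] = [set fold v].
      by rewrite image_setU !image_set1 fv g_fold // setUid.
    rewrite E; split; first by apply: Or31; exists (fold v).
    by apply: Or32; exists v => //; rewrite -setUA setUid.
  have E : g @` [set v; fold v] = [set v; fold v].
    by rewrite image_setU !image_set1 fv g_id //; apply/eqP.
  by rewrite E setUid; split; apply: Or32; exists v.
(* For [m = 1] the biclique contains [x0], so adding the folds changes nothing, and the image is
   [x0] alone. *)
have [m1|m1] := leqP m 1.
  have {m1}m1 : m = 1 by lia.
  have x0T : T x0.
    have [l0|la] := posnP (level a); first by rewrite -(level0 l0).
    have [l0|lb] := posnP (level b); first by rewrite -(level0 l0).
    case: ab; rewrite /color; have := Tm _ Ta; have := Tm _ Tb.
    move=> H1 H2; have -> : level a = 1 by lia.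
    by have -> : level b = 1 by lia.
  have E : g @` T = [set x0].
    apply/seteqP; split=> [_ [v Tv <-]|_ ->] /=.
      have := fold_at_level m0 (Tm _ Tv); rewrite m1 ltnS leqn0 => /eqP/level0.
      by rewrite -m1.
    by exists x0 => //; apply: g_id; rewrite level_x0; lia.
  rewrite E; split; first by apply: Or31; exists x0.
  rewrite (_ : T `|` _ = T); first by apply: Or33; split=> //; exists a, b.
  by apply/setUidPl => _ ->.
have g_color v : color (g v) = color v.
  have [vm|vm] := eqVneq (level v) m; last by rewrite g_id //; apply/eqP.
  by rewrite g_fold // color_fold ?vm.
have g_adj u v : T u -> T v -> color u <> color v -> adj (g u) v.
  move=> Tu Tv uv; have auv := cross _ _ Tu Tv uv.
  have [um|um] := eqVneq (level u) m; last by rewrite g_id //; apply/eqP.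
  rewrite g_fold //; apply: fold_adj; rewrite ?um //.
  by have := level_adj auv; have := Tm _ Tv; lia.
have g_adj2 u v : T u -> T v -> color u <> color v -> adj (g u) (g v).
  move=> Tu Tv uv; have auv := cross _ _ Tu Tv uv.
  have [um|um] := eqVneq (level u) m; last first.
    by rewrite (g_id u); [apply/adj_sym/g_adj => // e; apply: uv|apply/eqP].
  by rewrite (g_id v); [apply: g_adj|have := level_adj auv; lia].
split; apply: Or33; split.
- exact: finite_image.
- by move=> _ _ [u Tu <-] [v Tv <-]; rewrite !g_color; apply: g_adj2.
- by exists (g a), (g b); split; [exists a|exists b|rewrite !g_color].
- by rewrite finite_setU; split=> //; apply: finite_image.
- move=> u v [Tu|[u' Tu <-]] [Tv|[v' Tv <-]]; rewrite ?g_color.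
  + exact: cross.
  + by move=> uv; apply/adj_sym/g_adj => // e; apply: uv.
  + exact: g_adj.
  + exact: g_adj2.
- by exists a, b; split; [left|left|].
Qed.

Fixpoint fold_down k n v : V :=
  if k is k'.+1 then fold_at n.+1 (fold_down k' n.+1 v) else v.

(** The composite of [fold_at m] over all [m > n], the largest [m] first; on [v] only the factors
    with [m] at most [level v] matter. *)
Definition shrink n v : V := fold_down (level v - n) n v.

Lemma shrink_id n v : level v <= n -> shrink n v = v.
Proof. by rewrite /shrink -subn_eq0 => /eqP ->. Qed.

Lemma shrinkE n v : shrink n v = fold_at n.+1 (shrink n.+1 v).
Proof.
have [le|lt] := leqP (level v) n.
  rewrite !shrink_id // ?leqW // /fold_at; case: eqP => // e.
  by move: le; rewrite e ltnn.
by rewrite /shrink (_ : level v - n = (level v - n.+1).+1) //; lia.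
Qed.

Lemma shrink_level n v : level (shrink n v) <= n.
Proof.
have [k le] : exists k, level v <= n + k by exists (level v); apply: leq_addl.
elim: k n le => [|k IH] n le; first by rewrite shrink_id // -[n]addn0.
by rewrite shrinkE -ltnS; apply: fold_at_level => //; apply: IH; rewrite addSnnS.
Qed.

Lemma shrink0 v : shrink 0 v = x0.
Proof. by apply: level0; apply/eqP; rewrite -leqn0; apply: shrink_level. Qed.

Lemma shrink_image n T : shrink n @` T = fold_at n.+1 @` (shrink n.+1 @` T).
Proof. by rewrite image_comp; apply: eq_imagel => v _; apply: shrinkE. Qed.

Lemma level_bounded T : finite_set T -> exists n, forall v, T v -> level v <= n.
Proof.
move=> /finite_listP[s _ sP].
suff [n nP] : exists n, forall v : {classic V}, v \in s -> level v <= n.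
  by exists n => v /(sP v).2/nP.
elim: s {sP} => [|v s [n nP]]; first by exists 0.
exists (maxn (level v) n) => w; rewrite inE => /predU1P[->|/nP le].
  exact: leq_maxl.
by apply: leq_trans le _; apply: leq_maxr.
Qed.

(** Descending induction from a bound on the levels in [T], above which [shrink] does not affect
    [T]. *)
Lemma shrink_extended n T : extended T ->
  extended (shrink n @` T) /\ extended (shrink n @` T `|` shrink n.+1 @` T).
Proof.
move=> ET; have [_ finT _] := extended_local ET.
have [N TN] := level_bounded finT.
have E k m : N <= m + k -> extended (shrink m @` T).
  elim: k m => [|k IH] m le.
    rewrite (_ : shrink m @` T = T) //.
    have id v : T v -> shrink m v = v.
      by move=> Tv; apply: shrink_id; rewrite -[m]addn0 (leq_trans (TN v Tv)).
    by apply/seteqP; split=> [_ [v Tv <-]|v Tv]; [rewrite id|exists v; rewrite ?id].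
  rewrite shrink_image.
  have [||//] := @fold_at_extended m.+1 _ isT (IH m.+1 _); first by rewrite addSnnS.
  by move=> _ [v _ <-]; apply: shrink_level.
have E1 := E N; split; first by apply: (E N); apply: leq_addl.
rewrite shrink_image setUC.
have [||_ //] := @fold_at_extended n.+1 (shrink n.+1 @` T) isT.
  by apply: (E N); apply: leq_addl.
by move=> _ [v _ <-]; apply: shrink_level.
Qed.

Lemma extended1 v : extended [set v].
Proof. by apply: Or31; exists v. Qed.

(** Even stages are images under [shrink], odd ones the unions of two consecutive images, that is,
    the tops of the zigzags. The index increases towards the identity, as [zigzag_contractible]
    requires. *)
Definition stage n T : set V := shrink n./2 @` T `|` shrink (uphalf n) @` T.

Lemma stage_extended n T : extended T -> extended (stage n T).
Proof.
move=> /(shrink_extended n./2)[E1 E2]; rewrite /stage uphalf_half.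
by case: odd; [rewrite add1n|rewrite add0n setUid].
Qed.

Lemma stage_zigzag n T :
  if odd n then stage n.+1 T `<=` stage n T else stage n T `<=` stage n.+1 T.
Proof.
rewrite /stage -[n.+1./2]/(uphalf n) -[uphalf n.+1]/(n./2.+1) uphalf_half.
case: odd => /=; last by rewrite add0n setUid; apply: subsetUl.
by rewrite add1n setUid; apply: subsetUr.
Qed.

Lemma extended_contractible (R : realType) :
  contractible_total R (realization R (family extended)).
Proof.
refine (@zigzag_contractible R (family extended) (fun n S => member (stage_extended n (svalP S)))
  (member (extended1 x0)) _ _ _ _ _ _).
- exact: family_order.
- by apply: family_loc_finite finite_near2 _ => T; apply: extended_local.
- by move=> n S T /= ST; apply: setUSS; apply: image_subset.
- by move=> n S; have := stage_zigzag n (sval S); rewrite /alternate; case: odd.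
- move=> S; apply: family_inj; rewrite /= /stage /= setUid.
  have [[v Sv] _ _] := extended_local (svalP S).
  by apply/seteqP; split=> [_ [w _ <-]|_ ->] /=; [|exists v]; rewrite ?shrink0.
- move=> S; have [_ finS _] := extended_local (svalP S).
  have [N SN] := level_bounded finS; exists N.*2 => n le.
  have E m : N <= m -> shrink m @` sval S = sval S.
    have id v : N <= m -> sval S v -> shrink m v = v.
      by move=> Nm Sv; apply: shrink_id; apply: leq_trans (SN v Sv) Nm.
    by move=> Nm; apply/seteqP; split=> [_ [v Sv <-]|v Sv]; [rewrite id|exists v; rewrite ?id].
  have le1 : N <= n./2 by rewrite -(doubleK N) half_leq.
  apply: family_inj; rewrite /= /stage !E ?setUid // uphalf_half.
  exact: leq_trans le1 (leq_addl _ _).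
Qed.

(** * Removal of the pairs of a vertex and its fold *)

Definition reduced T : Prop := (exists v, T = [set v]) \/ biclique T.

Lemma reduced_extended T : reduced T -> extended T.
Proof. by case=> H; [apply: Or31|apply: Or33]. Qed.

Lemma reduced1 v : reduced [set v].
Proof. by left; exists v. Qed.

Lemma fold_pair_color A u v : fold_pair A -> A u -> A v -> color u = color v.
Proof. by move=> [w w1 ->] [->|->] [->|->]; rewrite ?color_fold. Qed.

Lemma fold_pair_sub A T : fold_pair A -> reduced T -> T `<=` A -> exists v, T = [set v].
Proof.
move=> pA [//|[_ _ [u [v [Tu Tv uv]]]]] TA.
by case: uv; apply: fold_pair_color pA _ _; apply: TA.
Qed.

Lemma fold_pair_sup A T : fold_pair A -> reduced T -> A `<=` T -> biclique T.
Proof.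
move=> [v v1 ->] [[w ->]|//] AT.
have vw : v = w := AT v (or_introl erefl).
have e : fold v = v by rewrite [RHS]vw; apply: (AT (fold v) (or_intror erefl)).
by have := level_fold v1; rewrite e; lia.
Qed.

Lemma fold_pair_link A : fold_pair A -> exists d, forall z, A z -> adj z d.
Proof.
move=> [v v1 ->]; have [d vd ld] := lower_neighbour (ltnW v1); exists d => z [->|->] //.
exact: fold_adj.
Qed.

(** The levels in a pair differ by exactly two, so an inclusion cannot interchange its vertices.
    Hence a chain contains at most one pair, and each pair can be its own label. *)
Lemma fold_pair_eq A B : fold_pair A -> fold_pair B -> A `<=` B -> A = B.
Proof.
move=> [v v1 ->] [w w1 ->] sub.
have [lv lw] := (level_fold v1, level_fold w1).
case: (sub v (or_introl erefl)) => [/= ->//|/= vw].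
by case: (sub (fold v) (or_intror erefl)) => /= e; move: lv (v1); rewrite e vw; lia.
Qed.

(** A set [T] above [A] may have further vertices of the colour of [A]. Once these are dropped, the
    rest lies in [link_top A]; going from [T] down to [pinch A T] and up to [link_top A] contracts
    the link of [A]. *)
Definition pinch A T : set V := [set y | T y /\ (A y \/ forall z, A z -> color y <> color z)].

Definition link_top A : set V := A `|` [set y | forall z, A z -> adj z y].

Definition nested (S T : set V) : Prop := S `<=` T \/ T `<=` S.

Lemma pinch_reduced A T : fold_pair A -> reduced T -> nested A T -> reduced (pinch A T).
Proof.
move=> pA rT [AT|TA].
  have [finT cross [u [v [Tu Tv uv]]]] := fold_pair_sup pA rT AT.
  right; split.
  - by apply: sub_finite_set finT => y [].
  - by move=> y z [Ty _] [Tz _]; apply: cross.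
  - have [a Aa] : exists a, A a by case: pA => a _ ->; exists a; left.
    have [w [Tw wa]] : exists w, T w /\ color w <> color a.
      have [ua|ua] := pselect (color u = color a); last by exists u.
      by exists v; split=> // va; apply: uv; rewrite ua va.
    exists w, a; split=> //; split; [by []|right=> z Az|exact: AT|by left].
    by rewrite (fold_pair_color pA Az Aa).
have [a Ta] := fold_pair_sub pA rT TA; left; exists a; rewrite /pinch Ta.
apply/seteqP; split=> [y []//|y ya]; split=> //; left.
by apply: TA; rewrite Ta.
Qed.

Lemma link_top_reduced A : fold_pair A -> reduced (link_top A).
Proof.
move=> pA; have [d Ad] := fold_pair_link pA.
have [a [Aa finA]] : exists a, A a /\ finite_set A.
  by case: pA => a _ ->; exists a; split; [left|exact: finite_set2].
right; split.
- rewrite finite_setU; split=> //.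
  by apply: sub_finite_set (finite_neighbours a) => y; apply.
- move=> y z [Ay|yA] [Az|zA] yz.
  + by case: yz; apply: fold_pair_color pA _ _.
  + exact: zA.
  + exact/adj_sym/yA.
  + case: yz; have := adj_color (yA _ Aa); have := adj_color (zA _ Aa).
    by case: (color a) (color y) (color z) => -[] [].
- by exists a, d; split; [left|right|exact/adj_color/Ad].
Qed.

Lemma pinch_link A T : fold_pair A -> reduced T -> nested A T -> pinch A T `<=` link_top A.
Proof.
move=> pA rT [AT|TA] y [Ty]; last by left; apply: TA.
case=> [|yA]; [by left|right=> z Az].
have [_ cross _] := fold_pair_sup pA rT AT.
by apply: cross; [apply: AT| |move=> e; apply: (yA z Az)].
Qed.

(** These zigzags go down first, so [o] is the reversed inclusion. *)
Lemma reduced_contractible (R : realType) :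
  contractible_total R (realization R (family reduced)).
Proof.
have missing (w : family extended) : (forall S, widen reduced_extended S <> w) ->
    fold_pair (sval w).
  move=> Ww; have := svalP w; case=> [H|//|H]; exfalso.
    by apply: (Ww (member (or_introl H : reduced (sval w)))); apply: family_inj.
  by apply: (Ww (member (or_intror H : reduced (sval w)))); apply: family_inj.
have linkP (i : family extended) (S : family reduced) : (exists w : family extended, [/\
    forall S, widen reduced_extended S <> w, w = i & comparable w (widen reduced_extended S)]) ->
    fold_pair (sval i) /\ nested (sval i) (sval S).
  by move=> [w [/missing pw <- iS]].
refine (@retract_contractible R _ _ (widen reduced_extended) _ _ _ _ (family extended) id
  (fun i S => member_or S (pinch (sval i) (sval S)))
  (fun i => member_or (member (reduced1 x0)) (link_top (sval i)))
  (fun S S' => cell_le S' S) _ _ _ _ _ _ _ (extended_contractible R)).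
- exact: family_order.
- by apply: family_loc_finite finite_near2 _ => T; apply: extended_local.
- by move=> S T /(congr1 sval) /= ST; apply: family_inj.
- by move=> S T.
- move=> w w' /missing pw /missing pw' [le|le]; apply: family_inj.
    exact: fold_pair_eq.
  by apply/esym/fold_pair_eq.
- by move=> S T U /= ST TU; apply: subset_trans TU ST.
- by move=> S T /= ST TS; apply/family_inj/seteqP.
- by move=> S T ST; right.
- by move=> S T [|]; [right|left].
- move=> i S T /linkP[pi iS] /linkP[_ iT] /= TS.
  rewrite !member_orE; try exact: pinch_reduced (svalP _) _.
  by move=> y [Ty H]; split=> //; apply: TS.
- move=> i S /linkP[pi iS]; rewrite /= !member_orE.
  + by split; [move=> y []|apply: pinch_link (svalP S) _].
  + exact: link_top_reduced.
  + exact: pinch_reduced (svalP S) _.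
Qed.

(** * Removal of the stars with several leaves *)

Local Notation cells := (cell_set color).

Lemma cells_reduced T : cells T -> reduced T.
Proof.
move=> cT; have [[v Tv] finT cross _] := cT.
have [[u [Tu uv]]|no] := pselect (exists u, T u /\ color u <> color v).
  by right; split=> //; exists u, v.
left; exists v; have mono w : T w -> color w = color v.
  by move=> Tw; apply: contrapT => wv; apply: no; exists w.
apply/seteqP; split=> [w Tw|_ -> //].
have : subsingleton (color_class color T (color v)).
  apply/(cell_setP (color v) cT) => x y [Tx e].
  by have := mono x Tx; rewrite e; case: (color v).
by apply; split=> //; apply: mono.
Qed.

(* The reduced sets that are not cells are the stars with several leaves. *)
Definition star_center T u : Prop := [/\ T u, subsingleton (color_class color T (color u)) &
  ~ subsingleton (color_class color T (~~ color u))].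

Lemma star_center_exists T : reduced T -> ~ cells T -> exists u, star_center T u.
Proof.
move=> [[v ->]|[finT cross [u [v [Tu Tv uv]]]]] nT; first by case: nT; apply: cell_set1.
have vu : color v = ~~ color u by move: uv; case: (color u) (color v) => -[].
have [su|su] := pselect (subsingleton (color_class color T (color u))).
  exists u; split=> // sv; apply: nT; split=> //; first by exists u.
  by move: su sv; case: (color u) => /=; tauto.
exists v; split=> //; last by rewrite vu negbK.
apply: contrapT => sv; apply: nT; split=> //; first by exists u.
by move: su sv; rewrite vu; case: (color u) => /=; tauto.
Qed.

(** Two leaves of [S] remain two vertices of one colour in [T], so this colour is not that of the
    centre of [T]. The centres then share a colour whose class in [T] is a single vertex. *)
Lemma star_center_sub S T u v : star_center S u -> star_center T v -> S `<=` T -> u = v.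
Proof.
move=> [Su _ big] [Tv sub _] ST.
have uv : color u = color v.
  apply: contrapT => uv; apply: big => x y [Sx xu] [Sy yu].
  have e : ~~ color u = color v by move: uv; case: (color u) (color v) => -[].
  by apply: sub; split; rewrite -?e //; apply: ST.
by apply: sub; split=> //; apply: ST.
Qed.

(** If [T] contains [S], it already contains [u]. If [T] lies in [S] and misses [u], it consists of
    leaves, and a cell of one colour is a single vertex, so adding [u] produces an edge. *)
Lemma star_center_cells S T u : star_center S u -> reduced S -> cells T -> nested S T ->
  cells (u |` T).
Proof.
move=> [Su sub _] rS cT ST.
have [Tu|Tu] := pselect (T u).
  by rewrite (_ : u |` T = T) //; apply/setUidPr => _ ->.
case: ST => [ST|TS]; first by case: Tu; apply: ST.
have colT w : T w -> color w = ~~ color u.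
  move=> Tw; have [wu|] := pselect (color w = color u); last first.
    by case: (color w) (color u) => -[].
  by case: Tu; rewrite -(sub w u) //; split=> //; apply: TS.
have [[v Tv] _ _ _] := cT.
have -> : T = [set v].
  have [[w Tw]|[_ _ [a [b [Ta Tb ab]]]]] := cells_reduced cT.
    by move: Tv; rewrite Tw => ->.
  by case: ab; rewrite (colT a Ta) (colT b Tb).
apply: cell_set2; first exact: adj_color.
case: rS => [[w Sw]|[_ cross _]].
  by move: (TS v Tv) Su Tu; rewrite Sw => <- ->.
by apply: cross => //; [apply: TS|rewrite (colT v Tv); case: (color u)].
Qed.

(** Stars can be comparable to each other, but only if they share their centre; so the label is the
    centre, and adding it to [T] is an operation common to all stars with that label. *)
Lemma cells_contractible (R : realType) :
  contractible_total R (realization R (family cells)).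
Proof.
have cells1 v : cells [set v] by apply: cell_set1.
have /choice[lab labP] : forall w : family reduced, exists u,
    ~ cells (sval w) -> star_center (sval w) u.
  move=> w; have [cw|cw] := pselect (cells (sval w)); first by exists x0.
  by have [u uw] := star_center_exists (svalP w) cw; exists u.
have missing (w : family reduced) : (forall S, widen cells_reduced S <> w) ->
    star_center (sval w) (lab w).
  by move=> Ww; apply: labP => cw; apply: (Ww (member cw)); apply: family_inj.
have linkP u (S : family cells) : (exists w : family reduced, [/\ forall S, widen cells_reduced S <> w,
    lab w = u & comparable w (widen cells_reduced S)]) -> cells (u |` sval S).
  by move=> [w [/missing cw <- wS]]; apply: star_center_cells cw (svalP w) (svalP S) wS.
refine (@retract_contractible R _ _ (widen cells_reduced) _ _ _ _ V lab
  (fun u S => member_or S (u |` sval S)) (fun u => member (cells1 u))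
  (@cell_le (family cells)) _ _ _ _ _ _ _ (reduced_contractible R)).
- exact: family_order.
- apply: family_loc_finite finite_near2 _ => T /reduced_extended.
  exact: extended_local.
- by move=> S T /(congr1 sval) /= ST; apply: family_inj.
- by move=> S T.
- move=> w w' /missing cw /missing cw' [le|le]; first exact: star_center_sub le.
  by apply/esym; apply: star_center_sub le.
- by move=> S T U /= ST TU; apply: subset_trans TU.
- by move=> S T /= ST TS; apply/family_inj/seteqP.
- by move=> S T ST; left.
- by [].
- by move=> u S T /linkP cS /linkP cT /= ST; rewrite !member_orE //; apply: setUS.
- by move=> u S /linkP cS; rewrite /= !member_orE.
Qed.

Lemma completion_contractible (R : realType) :
  contractible_total R (realization R (completion G)).
Proof.
have dart_eq (d d' : dart G) : src d = src d' -> tgt d = tgt d' -> d = d'.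
  exact: dart_inj.
have vs_cell c := completion_cell adj_color dart_eq c.
pose iota (c : completion G) : family cells := member (vs_cell c).
have iota_inj : injective iota.
  by move=> c c' /(congr1 sval)/(completion_inj adj_color dart_eq).
have iota_le c c' : cell_le c c' <-> cell_le (iota c) (iota c').
  exact: (completion_le adj_color dart_eq).
have iota_surj (w : family cells) : exists c, iota c = w.
  have [c cw] := completion_surj adj_color dart_eq (svalP w).
  by exists c; apply: family_inj.
have [c0 _] := iota_surj (member (cell_set1 color x0)).
have [cells_refl cells_trans cells_anti] := family_order cells.
(* As [iota] is an isomorphism, no element is missing; the retraction only transports the
   contraction, and the link data are placeholders. *)
refine (@retract_contractible R _ _ iota _ _ iota_inj iota_le unit (fun=> tt)
  (fun _ c => c) (fun=> c0) (@cell_le (completion G)) _ _ _ _ _ _ _ (cells_contractible R)).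
- exact: family_order.
- apply: family_loc_finite finite_near2 _ => T /cells_reduced/reduced_extended.
  exact: extended_local.
- by [].
- by move=> a b c /iota_le ab /iota_le bc; apply/iota_le; apply: cells_trans bc.
- by move=> a b /iota_le ab /iota_le ba; apply: iota_inj; apply: cells_anti.
- by move=> a b; left.
- by [].
- by [].
- by move=> _ c [w [Ww _ _]]; have [a aw] := iota_surj w; case: (Ww a).
Qed.

End Retractions.

Theorem theoremC (R : realType) (X : square_complex)
    (X_nonempty : exists v : vertex (skeleton1 X), True)
    (X_quadric : quadric X) :
  contractible R (realization R (completion (skeleton1 X))).
Proof.
have [lf conn _ iso4] := X_quadric; have [x0 _] := X_nonempty.
apply: contractible_totalW; apply: (completion_contractible conn iso4 _ x0).
by move=> v; have [] := lf v.
Qed.
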